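(* Let $R$ be a Cohen--Macaulay local ring of dimension $d>0$. Let $\mathcal{X}\subseteq\mathrm{CM}(R)$ be a resolving subcategory of $\mathrm{mod}\,R$ closed under cosyzygies (i.e. $\Omega^{-1}M\in\mathcal{X}$ for all $M\in\mathcal{X}$). Then $\mathcal{X}\subseteq\mathcal{G}(R)$. In particular, $R$ is Gorenstein if and only if $\mathrm{CM}(R)$ is closed under cosyzygies.
   Context: $R$ is a commutative Noetherian local ring; all modules are finitely generated; $\mathrm{mod}\,R$ is the category of finitely generated $R$-modules; subcategories are full and closed under isomorphism. $\mathrm{CM}(R)$ is the subcategory of maximal Cohen--Macaulay modules (including $0$). $(-)^*=\mathrm{Hom}_R(-,R)$. A subcategory $\mathcal{X}$ of $\mathrm{mod}\,R$ is resolving if it contains all finitely generated projective $R$-modules and is closed under direct summands, extensions, and kernels of epimorphisms. $\mathcal{G}(R)$ is the subcategory of totally reflexive modules: those $M$ for which the natural map $M\to M^{**}$ is bijective and $\mathrm{Ext}^i_R(M,R)=\mathrm{Ext}^i_R(M^*,R)=0$ for all $i>0$. Cosyzygy: a left $\mathrm{add}(R)$-approximation of $M$ is a homomorphism $f:M\to P$ with $P$ finitely generated projective such that every homomorphism from $M$ to a finitely generated projective module factors through $f$; it is minimal if every endomorphism $g$ of $P$ with $gf=f$ is an automorphism. $\Omega^{-1}M$ is the cokernel of a minimal left $\mathrm{add}(R)$-approximation of $M$. *)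

(* Defs.v *)
From HB Require Import structures.
From mathcomp Require Import all_boot all_order all_algebra.
From mathcomp Require Import ring_quotient.
From mathcomp Require Import boolp classical_sets functions.

Set Implicit Arguments.
Unset Strict Implicit.
Unset Printing Implicit Defensive.

Import GRing.Theory.
Local Open Scope classical_set_scope.
Local Open Scope ring_scope.

Section Rings.
Variable R : comNzRingType.

(* [idealr_closed] includes properness ([1 \notin _]). *)
Definition proper_ideal_set (I : set R) : Prop :=
  idealr_closed [pred x | x \in I].

Definition prime_ideal (p : set R) : Prop :=
  proper_ideal_set p /\ prime_idealr_closed [pred x | x \in p].

Definition maximal_ideal (m : set R) : Prop :=
  proper_ideal_set m /\
  forall I : set R, proper_ideal_set I -> m `<=` I -> I = m.

Definition lin_span (M : lmodType R) (s : seq M) : set M :=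
  [set x | exists c : 'I_(size s) -> R, x = \sum_(i < size s) c i *: s`_i].

(* The only non-proper ideal, R itself, is generated by 1, so it suffices to
   quantify over the proper ones. *)
Definition noetherian_ring : Prop :=
  forall I : set R, proper_ideal_set I ->
    exists s : seq R, I = lin_span (s : seq R^o).

Definition local_ring (m : set R) : Prop :=
  maximal_ideal m /\ forall n : set R, maximal_ideal n -> n = m.

Definition prime_chain (n : nat) (p : nat -> set R) : Prop :=
  (forall i, (i <= n)%N -> prime_ideal (p i)) /\
  (forall i, (i < n)%N -> p i `<` p i.+1).

Definition krull_dim (d : nat) : Prop :=
  (exists p, prime_chain d p) /\
  (forall n p, prime_chain n p -> (n <= d)%N).

End Rings.

Arguments noetherian_ring : clear implicits.
Arguments krull_dim : clear implicits.

Section Modules.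
Variable R : comNzRingType.
Implicit Types L M N P Q A B C : lmodType R.

Definition surjective_map A B (f : A -> B) : Prop := forall y, exists x, y = f x.

Definition exact_at A B C (f : A -> B) (g : B -> C) : Prop :=
  forall y, g y = 0 <-> exists x, y = f x.

Definition fin_gen M : Prop := exists s : seq M, lin_span s = setT.

Definition zero_module M : Prop := forall x : M, x = 0.

Definition isomorphic M N : Prop := exists f : {linear M -> N}, bijective f.

Definition short_exact L M N (f : {linear L -> M}) (g : {linear M -> N}) :=
  [/\ injective f, exact_at f g & surjective_map g].

Definition projective P : Prop :=
  forall A B (g : {linear A -> B}) (f : {linear P -> B}), surjective_map g ->
    exists h : {linear P -> A}, forall x, f x = g (h x).

Definition injective_module (E : lmodType R) : Prop :=
  forall A B (g : {linear A -> B}) (f : {linear A -> E}), injective g ->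
    exists h : {linear B -> E}, forall x, f x = h (g x).

Definition fg_projective P : Prop := fin_gen P /\ projective P.

End Modules.

Section HomModule.
Variables (R : comNzRingType) (M N : lmodType R).

Definition is_linear : {pred M -> N} := fun f => `[< linear f >].

Record hom_mod := HomMod { hom_mod_fun :> M -> N; _ : hom_mod_fun \in is_linear }.

HB.instance Definition _ := [isSub for hom_mod_fun].
HB.instance Definition _ := [Choice of hom_mod by <:].

Fact is_linear_submod_closed : submod_closed is_linear.
Proof.
split=> [|a f g /asboolP lf /asboolP lg]; apply/asboolP => b x y /=.
  by rewrite scaler0 addr0.
by rewrite !fctE lf lg !scalerDr !scalerA (mulrC a b) addrACA.
Qed.

HB.instance Definition _ :=
  GRing.isSubmodClosed.Build R (M -> N) is_linear is_linear_submod_closed.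
HB.instance Definition _ := [SubChoice_isSubLmodule of hom_mod by <:].

End HomModule.

Definition dual_module (R : comNzRingType) (M : lmodType R) : lmodType R :=
  hom_mod M R^o.

Section Biduality.
Variables (R : comNzRingType) (M : lmodType R).

Fact evaluation_linear (x : M) :
  (fun f : dual_module M => (f : hom_mod M R^o) x)
    \in @is_linear R (dual_module M) R^o.
Proof. by apply/asboolP => a f g. Qed.

Definition biduality (x : M) : dual_module (dual_module M) :=
  HomMod (evaluation_linear x).

End Biduality.

Section Homological.
Variable R : comNzRingType.
Implicit Types M N : lmodType R.

Record projective_resolution M := ProjectiveResolution {
  pr_mod : nat -> lmodType R;
  pr_diff : forall i, {linear pr_mod i.+1 -> pr_mod i};
  pr_aug : {linear pr_mod 0%N -> M};
  _ : forall i, projective (pr_mod i);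
  _ : surjective_map pr_aug;
  _ : exact_at (pr_diff 0%N) pr_aug;
  _ : forall i, exact_at (pr_diff i.+1) (pr_diff i) }.

Section HomComplex.
Variables (M N : lmodType R) (P : projective_resolution M).

Definition cocycle i (phi : {linear pr_mod P i -> N}) : Prop :=
  forall x, phi (pr_diff P i x) = 0.

Definition coboundary i : {linear pr_mod P i -> N} -> Prop :=
  match i with
  | 0%N => fun phi => forall x, phi x = 0
  | j.+1 => fun phi => exists psi : {linear pr_mod P j -> N},
              forall x, phi x = psi (pr_diff P j x)
  end.

End HomComplex.

(* H^i(Hom(P, N)) = 0 for a projective resolution P of M; which P is used is
   immaterial, as this cohomology does not depend on it up to isomorphism. *)
Definition Ext_zero (i : nat) M N : Prop :=
  exists P : projective_resolution M,
    forall phi : {linear pr_mod P i -> N}, cocycle phi -> coboundary phi.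

Record injective_resolution M := InjectiveResolution {
  ir_mod : nat -> lmodType R;
  ir_diff : forall i, {linear ir_mod i -> ir_mod i.+1};
  ir_aug : {linear M -> ir_mod 0%N};
  _ : forall i, injective_module (ir_mod i);
  _ : injective ir_aug;
  _ : exact_at ir_aug (ir_diff 0%N);
  _ : forall i, exact_at (ir_diff i) (ir_diff i.+1) }.

Definition finite_inj_dim M : Prop :=
  exists (I : injective_resolution M) (n : nat),
    forall i, (n < i)%N -> zero_module (ir_mod I i).

Definition totally_reflexive M : Prop :=
  [/\ fin_gen M, bijective (@biduality R M) &
      forall i, (0 < i)%N ->
        Ext_zero i M R^o /\ Ext_zero i (dual_module M) R^o].

End Homological.

(* For R Noetherian local. *)
Definition gorenstein (R : comNzRingType) : Prop := finite_inj_dim R^o.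

Section CohenMacaulay.
Variables (R : comNzRingType) (m : set R).
Implicit Types M : lmodType R.

(* The submodule (s_0, ..., s_{n-1})M of M. *)
Definition ideal_mul (s : seq R) M : set M :=
  [set y | exists z : 'I_(size s) -> M, y = \sum_(i < size s) s`_i *: z i].

Definition regular_seq M (s : seq R) : Prop :=
  [/\ forall i, (i < size s)%N -> m s`_i,
      forall i, (i < size s)%N -> forall y : M,
        ideal_mul (take i s) (s`_i *: y) -> ideal_mul (take i s) y &
      exists y : M, ~ ideal_mul s y].

(* Not defined for M = 0, for which [regular_seq] never holds. *)
Definition depth M (n : nat) : Prop :=
  (exists s, regular_seq M s /\ size s = n) /\
  (forall s, regular_seq M s -> (size s <= n)%N).

Definition cohen_macaulay_ring : Prop :=
  exists n, krull_dim R n /\ depth R^o n.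

Definition maximal_CM M : Prop :=
  fin_gen M /\ (zero_module M \/ exists n, krull_dim R n /\ depth M n).

End CohenMacaulay.

Section Subcategories.
Variable R : comNzRingType.
Implicit Types (X : lmodType R -> Prop) (L M N P Q C : lmodType R).

Definition subcategory X : Prop :=
  (forall M, X M -> fin_gen M) /\
  (forall M N, isomorphic M N -> X M -> X N).

Definition resolving X : Prop :=
  [/\ subcategory X,
      forall P, fg_projective P -> X P,
      forall M N, X (M * N)%type -> X M,
      forall L M N (f : {linear L -> M}) (g : {linear M -> N}),
        short_exact f g -> X L -> X N -> X M &
      forall L M N (f : {linear L -> M}) (g : {linear M -> N}),
        short_exact f g -> X M -> X N -> X L].

Definition left_addR_approx M P (f : {linear M -> P}) : Prop :=
  fg_projective P /\
  forall Q (h : {linear M -> Q}), fg_projective Q ->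
    exists g : {linear P -> Q}, forall x, h x = g (f x).

Definition minimal_left_addR_approx M P (f : {linear M -> P}) : Prop :=
  left_addR_approx f /\
  forall g : {linear P -> P}, (forall x, g (f x) = f x) -> bijective g.

(* A relation, since the minimal approximation and its cokernel are determined
   only up to isomorphism. *)
Definition cosyzygy M C : Prop :=
  exists (P : lmodType R) (f : {linear M -> P}) (p : {linear P -> C}),
    [/\ minimal_left_addR_approx f, surjective_map p & exact_at f p].

Definition closed_under_cosyzygies X : Prop :=
  forall M C, X M -> cosyzygy M C -> X C.

End Subcategories.

(* Main.v *)
From HB Require Import structures.
Require Import Defs.
From mathcomp Require Import all_boot all_order all_algebra.
From mathcomp Require Import boolp classical_sets functions.

(** The heart of the matter is that [Ext^1(M, R) = 0] for all [M] in a resolving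
    subcategory [X] of maximal Cohen--Macaulay modules that is closed under
    cosyzygies ([ext1_resolving]).

    If [Ext^1(E, R) = 0] for some [E] in [X], then [E] is torsionless
    ([torsionless_of_ext1]).  As [d > 0], there is an element [x] of the maximal
    ideal that is regular on [R] and hence on every maximal Cohen--Macaulay module.
    The syzygy [L] of [E / xE] is an extension of [E] by its syzygy, so it lies in
    [X]; its cosyzygy, which lies in [X] too, contains the kernel of
    [E / xE -> (R / xR)^n], where the map is given by generators of
    [Hom(E, R / xR)].  That kernel is killed by [x] and must vanish.  Since
    [Hom(E, R) -> Hom(E, R / xR)] is surjective, an element of [E] killed by all
    forms lies in [xE], and Nakayama's lemma applies.

    For a general [M] in [X], take the universal extension
    [0 -> R^n -> E -> M -> 0] defined by minimal generators of [Ext^1(M, R)].  Then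
    [E] is torsionless and embeds into some [R^l] with cokernel in [X], so
    [G = R^l / R^n] lies in [X].  As [G] has depth [d], the Auslander--Buchsbaum
    argument ([minimal_presentation_MCM]) shows that the map [R^n -> R^l] is
    injective modulo the maximal ideal, which contradicts the minimality of the
    generators unless [n = 0].

    Total reflexivity is then formal: every [M] in [X] embeds into a free module
    with cokernel [C] in [X], the dual sequence [0 -> C* -> R^n -> M* -> 0] is exact,
    and so on with [C] in place of [M] ([X_totally_reflexive]).

    If maximal Cohen--Macaulay modules are closed under cosyzygies, the same
    vanishing holds for all of them, in particular for all [d]-th syzygies.  By
    dimension shifting and Baer's criterion the [d]-th cosyzygy in any injective
    resolution of [R] is injective ([finite_inj_dim_of_syzygies]); injective
    modules abound because [Hom_Z(R, D)] is injective for [D] a power of [Q / Z].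

    Conversely, let [R] have finite injective dimension.  Descending on the degree,
    with Nakayama's lemma and a noetherian induction that leads to the residue
    field, one finds that [Ext^i(N, R) = 0] for all [i > d] and all finitely
    generated [N] ([Ext_vanishes_descend]); going down a regular sequence,
    [Ext^1(M, R) = 0] for [M] maximal Cohen--Macaulay ([ext1_MCM]).  Dualizing free
    resolutions then shows that such an [M] is reflexive with maximal
    Cohen--Macaulay dual, so that it embeds into a free module with maximal
    Cohen--Macaulay cokernel, of which, up to a projective summand, the cosyzygy of
    [M] is a direct summand ([MCM_closed_under_cosyzygies]).

    All this needs the depth of a module to behave well in exact sequences and not
    to depend on the chosen regular sequence ([depth_ge_independent]), and to be
    bounded by the length of chains of primes ([depth_ge_prime_chain]). *)

Set Implicit Arguments.
Unset Strict Implicit.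
Unset Printing Implicit Defensive.

Import GRing.Theory.
Local Open Scope classical_set_scope.
Local Open Scope ring_scope.

(** * Submodules, quotients and linear maps *)

Section Submodules.
Variable R : comNzRingType.
Implicit Types L M N P Q A B C E F I : lmodType R.

Definition submod M (U : set M) : Prop :=
  U 0 /\ forall (a : R) x y, U x -> U y -> U (a *: x + y).

Lemma submodD M (U : set M) x y : submod U -> U x -> U y -> U (x + y).
Proof. by case=> _ h Ux Uy; rewrite -[x]scale1r; apply: h. Qed.

Lemma submodZ M (U : set M) a x : submod U -> U x -> U (a *: x).
Proof. by case=> h0 h Ux; rewrite -[_ *: _]addr0; apply: h. Qed.

Lemma submodN M (U : set M) x : submod U -> U x -> U (- x).
Proof. by move=> h Ux; rewrite -scaleN1r; apply: submodZ. Qed.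

Lemma submodB M (U : set M) x y : submod U -> U x -> U y -> U (x - y).
Proof. by move=> h Ux Uy; apply: submodD => //; apply: submodN. Qed.

Lemma submod_sum M (U : set M) n (F : 'I_n -> M) :
  submod U -> (forall i, U (F i)) -> U (\sum_(i < n) F i).
Proof.
by move=> h hF; apply: big_ind => //; [case: h|move=> x y; apply: submodD].
Qed.

Lemma submod_zero M : submod ([set 0] : set M).
Proof. by split=> // a x y /= -> ->; rewrite scaler0 addr0. Qed.

Lemma submod_preimage M N (f : {linear M -> N}) (U : set N) :
  submod U -> submod (f @^-1` U).
Proof.
move=> [U0 h]; split=> [|a x y /= Ux Uy]; first by rewrite /= linear0.
by rewrite linearP; apply: h.
Qed.

Lemma submod_image M N (f : {linear M -> N}) (U : set M) :
  submod U -> submod (f @` U).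
Proof.
move=> [U0 h]; split=> [|a _ _ [x Ux <-] [y Uy <-]].
  by exists 0 => //; rewrite linear0.
by exists (a *: x + y); [apply: h|rewrite linearP].
Qed.

Lemma submod_ker M N (f : {linear M -> N}) : submod [set x | f x = 0].
Proof. exact: (submod_preimage f (submod_zero N)). Qed.

Lemma submod_range M N (f : {linear M -> N}) : submod [set y | exists x, y = f x].
Proof.
split=> [|a _ _ [x ->] [y ->]]; first by exists 0; rewrite linear0.
by exists (a *: x + y); rewrite linearP.
Qed.

Lemma submod_prod M N (U : set M) (V : set N) :
  submod U -> submod V -> submod [set p : M * N | U p.1 /\ V p.2].
Proof.
move=> [U0 hU] [V0 hV]; split=> [//|a x y [? ?] [? ?]].
by split; [apply: hU|apply: hV].
Qed.

(** Maps that descend to a quotient or lift to a submodule are constructed from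
    their graphs. *)
Lemma linear_of_relation A B (G : A -> B -> Prop) :
  (forall x, exists y, G x y) ->
  (forall a x y x' y', G x y -> G x' y' -> G (a *: x + x') (a *: y + y')) ->
  (forall y, G 0 y -> y = 0) ->
  exists f : {linear A -> B}, forall x y, G x y <-> f x = y.
Proof.
move=> tot add fun0.
have uniq x y y' : G x y -> G x y' -> y = y'.
  move=> /(add (-1)) h /h; rewrite !scaleN1r addNr => /fun0 /eqP.
  by rewrite addrC subr_eq0 => /eqP.
have [f Gf] := choice tot.
have lf : linear f by move=> a x y; apply: uniq (Gf _) _; apply: add.
pose l := GRing.isLinear.Build R A B _ f lf.
pose F : {linear A -> B} := HB.pack f l.
exists F => x y; split=> [|<-]; [exact: uniq|exact: Gf].
Qed.

Definition mk_linear A B (f : A -> B) (lf : linear f) : {linear A -> B} :=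
  HB.pack f (GRing.isLinear.Build R A B _ f lf).

Lemma mk_linearE A B (f : A -> B) (lf : linear f) x : mk_linear lf x = f x.
Proof. by []. Qed.

Lemma factor_through_surj A N B (q : {linear A -> N}) (g : {linear A -> B}) :
  surjective_map q -> (forall x, q x = 0 -> g x = 0) ->
  exists h : {linear N -> B}, forall x, h (q x) = g x.
Proof.
move=> qs qg.
have [||_ [x /qg -> <-]//|h hP] :=
  @linear_of_relation N B (fun y b => exists2 x, q x = y & g x = b).
- by move=> y; have [x ->] := qs y; exists (g x), x.
- move=> a _ _ _ _ [x <- <-] [x' <- <-].
  by exists (a *: x + x'); rewrite linearP.
by exists h => x; apply/hP; exists x.
Qed.

Lemma lift_along_inj A B I (i : {linear B -> I}) (g : {linear A -> I}) :
  injective i -> (forall x, exists y, g x = i y) ->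
  exists h : {linear A -> B}, forall x, i (h x) = g x.
Proof.
move=> ii gi.
have [||y|h hP] := @linear_of_relation A B (fun x y => g x = i y) => //.
- by move=> a x y x' y' h h'; rewrite !linearP h h'.
- by rewrite linear0 => e; apply: ii; rewrite linear0.
by exists h => x; apply/esym/hP.
Qed.

End Submodules.

Section SubmoduleType.
Variables (R : comNzRingType) (M : lmodType R) (U : set M) (hU : submod U).

Definition in_submod of submod U : {pred M} := fun x => `[<U x>].

Record submodule := Submodule { submodule_val :> M; _ : submodule_val \in in_submod hU }.

HB.instance Definition _ := [isSub for submodule_val].
HB.instance Definition _ := [Choice of submodule by <:].

Fact in_submod_closed : submod_closed (in_submod hU).
Proof.
split=> [|a x y /asboolP Ux /asboolP Uy]; apply/asboolP; first by case: hU.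
by case: hU => _; apply.
Qed.

HB.instance Definition _ :=
  GRing.isSubmodClosed.Build R M (in_submod hU) in_submod_closed.
HB.instance Definition _ := [SubChoice_isSubLmodule of submodule by <:].

Fact submodule_incl_linear : linear (submodule_val : submodule -> M).
Proof. by []. Qed.

Definition submodule_incl : {linear submodule -> M} := mk_linear submodule_incl_linear.

Lemma submodule_inclP (x : submodule) : U (submodule_incl x).
Proof. by case: x => x /= /asboolP. Qed.

Lemma submodule_incl_inj : injective submodule_incl.
Proof. exact: val_inj. Qed.

Lemma submodule_incl_ex x : U x -> exists y : submodule, x = submodule_incl y.
Proof.
move=> Ux; have hx : x \in in_submod hU by apply/asboolP.
by exists (Submodule hx).
Qed.

End SubmoduleType.

Section Quotient.
Variables (R : comNzRingType) (M : lmodType R) (U : set M) (hU : submod U).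

(** The quotient module is carried by a set of chosen representatives of the
    cosets. *)
Definition repr_of of submod U : M -> M := fun x => xget 0 [set y | U (x - y)].

Lemma repr_ofP x : U (x - repr_of hU x).
Proof.
apply: (@xgetPex _ 0 [set y | U (x - y)]); exists x => /=; rewrite subrr.
by case: hU.
Qed.

Lemma eq_repr_of x y : repr_of hU x = repr_of hU y <-> U (x - y).
Proof.
split=> [e|Uxy].
  rewrite -[x - y](subrKA (repr_of hU x)) {2}e.
  apply: submodD => //; first exact: repr_ofP.
  by rewrite -opprB; apply: submodN => //; apply: repr_ofP.
rewrite /repr_of; congr (xget _ _); apply/seteqP; split=> z /= Uz.
  by rewrite -(subrKA x) -opprB; apply: submodD => //; apply: submodN.
by rewrite -(subrKA y); apply: submodD.
Qed.

Record quotient_module := Quot { quot_val : M; _ : repr_of hU quot_val == quot_val }.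

HB.instance Definition _ := [isSub for quot_val].
HB.instance Definition _ := [Choice of quotient_module by <:].

Fact repr_of_idem x : repr_of hU (repr_of hU x) == repr_of hU x.
Proof.
by apply/eqP/eq_repr_of; rewrite -opprB; apply: submodN => //; apply: repr_ofP.
Qed.

Definition qproj x : quotient_module := Quot (repr_of_idem x).

Lemma eq_qproj x y : qproj x = qproj y <-> U (x - y).
Proof.
split=> [[/eq_repr_of]//|/eq_repr_of e]; exact: val_inj.
Qed.

Lemma qproj_val z : qproj (quot_val z) = z.
Proof. by apply: val_inj => /=; case: z => z /= /eqP. Qed.

Definition qadd (a b : quotient_module) := qproj (quot_val a + quot_val b).
Definition qopp (a : quotient_module) := qproj (- quot_val a).
Definition qscale r (a : quotient_module) := qproj (r *: quot_val a).

Lemma qaddE x y : qadd (qproj x) (qproj y) = qproj (x + y).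
Proof.
apply/eq_qproj; rewrite /= opprD addrACA; apply: submodD => //.
  by rewrite -opprB; apply: submodN => //; apply: repr_ofP.
by rewrite -opprB; apply: submodN => //; apply: repr_ofP.
Qed.

Lemma qoppE x : qopp (qproj x) = qproj (- x).
Proof. by apply/eq_qproj; rewrite /= opprK addrC; apply: repr_ofP. Qed.

Lemma qscaleE r x : qscale r (qproj x) = qproj (r *: x).
Proof.
apply/eq_qproj; rewrite /= -scalerBr; apply: submodZ => //.
by rewrite -opprB; apply: submodN => //; apply: repr_ofP.
Qed.

Fact qaddA : associative qadd.
Proof.
by move=> a b c; rewrite -[a]qproj_val -[b]qproj_val -[c]qproj_val !qaddE addrA.
Qed.
Fact qaddC : commutative qadd.
Proof. by move=> a b; rewrite -[a]qproj_val -[b]qproj_val !qaddE addrC. Qed.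
Fact qadd0 : left_id (qproj 0) qadd.
Proof. by move=> a; rewrite -[a]qproj_val !qaddE add0r. Qed.
Fact qaddN : left_inverse (qproj 0) qopp qadd.
Proof. by move=> a; rewrite -[a]qproj_val qoppE !qaddE addNr. Qed.

HB.instance Definition _ := GRing.isZmodule.Build quotient_module qaddA qaddC qadd0 qaddN.

Fact qscaleA a b v : qscale a (qscale b v) = qscale (a * b) v.
Proof. by rewrite -[v]qproj_val !qscaleE scalerA. Qed.
Fact qscale1 : left_id 1 qscale.
Proof. by move=> v; rewrite -[v]qproj_val !qscaleE scale1r. Qed.
Fact qscaleDr : right_distributive qscale +%R.
Proof.
move=> a u v; rewrite -[u]qproj_val -[v]qproj_val.
by rewrite [_ + _]qaddE !qscaleE [RHS]qaddE scalerDr.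
Qed.
Fact qscaleDl v : {morph qscale^~ v : a b / a + b}.
Proof.
by move=> a b; rewrite -[v]qproj_val !qscaleE [RHS]qaddE scalerDl.
Qed.

HB.instance Definition _ :=
  GRing.Zmodule_isLmodule.Build R quotient_module qscaleA qscale1 qscaleDr qscaleDl.

Fact qproj_linear : linear qproj.
Proof. by move=> a x y; rewrite -qaddE -qscaleE. Qed.

Definition quotient_map : {linear M -> quotient_module} := mk_linear qproj_linear.

Lemma quotient_map_surj : surjective_map quotient_map.
Proof. by move=> z; exists (quot_val z); rewrite mk_linearE qproj_val. Qed.

Lemma quotient_map_eq0 x : quotient_map x = 0 <-> U x.
Proof. by rewrite -[X in U X]subr0 -eq_qproj. Qed.

End Quotient.

Arguments submodule_incl_inj {R M U} hU.
Arguments submodule_inclP {R M U hU} x.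
Arguments quotient_map_surj {R M U} hU.
Arguments quotient_map_eq0 {R M U} hU x.

Section Maps.
Variable R : comNzRingType.
Implicit Types L M N P Q A B C E F I : lmodType R.

Lemma quot_exact M (U : set M) (hU : submod U) :
  short_exact (submodule_incl hU) (quotient_map hU).
Proof.
split; [exact: submodule_incl_inj| |exact: quotient_map_surj] => y;
  rewrite quotient_map_eq0.
by split=> [/(submodule_incl_ex hU)|[x ->]]; last exact: submodule_inclP.
Qed.

Lemma ker_exact M N (f : {linear M -> N}) :
  surjective_map f -> short_exact (submodule_incl (submod_ker f)) f.
Proof.
move=> fs; split=> // [|y]; first exact: submodule_incl_inj.
split=> [|[x ->]]; [exact: (submodule_incl_ex (submod_ker f))|exact: (submodule_inclP x)].
Qed.

Lemma coker_exact M N (f : {linear M -> N}) :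
  injective f -> short_exact f (quotient_map (submod_range f)).
Proof.
by move=> fi; split=> // [y|]; [rewrite quotient_map_eq0|exact: quotient_map_surj].
Qed.

Lemma injective_ker M N (f : {linear M -> N}) :
  (forall x, f x = 0 -> x = 0) -> injective f.
Proof.
move=> h x y e; apply/eqP; rewrite -subr_eq0; apply/eqP/h.
by rewrite linearB e subrr.
Qed.

Definition prod_inl M N : {linear M -> (M * N)%type} :=
  mk_linear (f := fun x => (x, 0 : N)) (fun a x y =>
    congr1 (pair _) (esym (etrans (addr0 _) (scaler0 _ _)))).

Definition prod_inr M N : {linear N -> (M * N)%type} :=
  mk_linear (f := fun x => (0 : M, x)) (fun a x y =>
    congr1 (pair^~ _) (esym (etrans (addr0 _) (scaler0 _ _)))).

Definition prod_fst M N : {linear (M * N)%type -> M} :=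
  mk_linear (f := fun x : M * N => x.1) (fun a x y => erefl).

Definition prod_snd M N : {linear (M * N)%type -> N} :=
  mk_linear (f := fun x : M * N => x.2) (fun a x y => erefl).

Lemma prod_exact M N : short_exact (prod_inl M N) (prod_snd M N).
Proof.
split; [by move=> x y []| |by move=> y; exists (0, y)].
by move=> [x y]; split=> [/= ->|[z []]//]; exists x.
Qed.

Definition scale_by M (a : R) : {linear M -> M} := *:%R a.

(** Injectivity of [E] for the embedding of [M' / k^-1 U] in [M / U]. *)
Lemma injective_module_ext (E M' M : lmodType R) (k : {linear M' -> M})
    (U : set M) (g : {linear M' -> E}) :
  injective_module E -> submod U -> (forall x, U (k x) -> g x = 0) ->
  exists2 h : {linear M -> E}, (forall x, h (k x) = g x) & (forall u, U u -> h u = 0).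
Proof.
move=> Einj hU gU.
have hV := submod_preimage k hU.
have [kb kbE] : exists kb : {linear quotient_module hV -> quotient_module hU},
    forall x, kb (quotient_map hV x) = quotient_map hU (k x).
  apply: (factor_through_surj (g := quotient_map hU \o k)); first exact: quotient_map_surj.
  by move=> x /quotient_map_eq0 Ux; apply/quotient_map_eq0.
have [gb gbE] : exists gb : {linear quotient_module hV -> E}, forall x,
  gb (quotient_map hV x) = g x.
  by apply: factor_through_surj; [exact: quotient_map_surj|move=> x /quotient_map_eq0 /gU].
have kbi : injective kb.
  apply: injective_ker => y; have [x ->] := quotient_map_surj _ y.
  by rewrite kbE => /quotient_map_eq0 Ux; apply/quotient_map_eq0.
have [h hE] := Einj _ _ kb gb kbi.
exists (h \o quotient_map hU) => [x|u Uu].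
  by rewrite -[LHS]/(h (quotient_map hU (k x))) -kbE -hE gbE.
rewrite -[LHS]/(h (quotient_map hU u)) (_ : quotient_map hU u = 0) ?linear0 //.
exact/quotient_map_eq0.
Qed.

End Maps.

(** * Noetherian modules *)

Section Span.
Variable R : comNzRingType.
Implicit Types L M N P Q A B C E F : lmodType R.

Lemma lin_span_nil M (x : M) : lin_span [::] x <-> x = 0.
Proof.
split=> [[c ->]|->]; first by rewrite big_ord0.
by exists (fun _ => 0); rewrite big_ord0.
Qed.

Lemma lin_span_cons M (a : M) s x :
  lin_span (a :: s) x <-> exists c y, lin_span s y /\ x = c *: a + y.
Proof.
split=> [[c ->]|[c [_ [[e ->] ->]]]].
  exists (c ord0), (\sum_(i < size s) c (lift ord0 i) *: s`_i).
  by split; [exists (c \o lift ord0)|rewrite big_ord_recl].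
exists (fun i => if unlift ord0 i is Some j then e j else c).
by rewrite big_ord_recl unlift_none; congr (_ + _); apply: eq_bigr => i _; rewrite liftK.
Qed.

Lemma submod_span M (s : seq M) : submod (lin_span s).
Proof.
split=> [|a _ _ [c ->] [e ->]].
  by exists (fun _ => 0); rewrite big1 // => i _; rewrite scale0r.
exists (fun i => a * c i + e i); rewrite scaler_sumr -big_split /=.
by apply: eq_bigr => i _; rewrite scalerDl scalerA.
Qed.

Lemma span_min M (s : seq M) (U : set M) :
  submod U -> (forall a, a \in s -> U a) -> lin_span s `<=` U.
Proof.
move=> hU sU _ [c ->]; apply: submod_sum => // i; apply: submodZ => //.
by apply/sU/mem_nth.
Qed.

Lemma mem_span M (s : seq M) a : a \in s -> lin_span s a.
Proof.
elim: s => // b s IH; rewrite inE => /orP[/eqP ->|/IH h]; apply/lin_span_cons.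
  by exists 1, 0; rewrite scale1r addr0; split=> //; case: (submod_span s).
by exists 0, a; rewrite scale0r add0r.
Qed.

Lemma span_map M N (f : {linear M -> N}) (s : seq M) y :
  lin_span (map f s) y <-> exists2 x, lin_span s x & y = f x.
Proof.
split.
  apply: (@span_min _ _ [set y | exists2 x, lin_span s x & y = f x]).
    split=> [|a _ _ [x sx ->] [x' sx' ->]].
      by exists 0; [case: (submod_span s)|rewrite linear0].
    exists (a *: x + x'); last by rewrite linearP.
    by case: (submod_span s) => _; apply.
  by move=> _ /mapP[x sx ->]; exists x => //; apply: mem_span.
case=> x sx ->; move: x sx.
apply: (@span_min _ _ (f @^-1` lin_span (map f s))).
  exact/submod_preimage/submod_span.
by move=> a sa; apply: mem_span; apply: map_f.
Qed.

Lemma fin_gen_surj M N (f : {linear M -> N}) :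
  surjective_map f -> fin_gen M -> fin_gen N.
Proof.
move=> fs [s es]; exists (map f s); apply/seteqP; split=> // y _.
have [x ->] := fs y; apply/span_map; exists x => //.
by rewrite es.
Qed.

End Span.

Section Noetherian.
Variables (R : comNzRingType) (R_noetherian : noetherian_ring R).
Implicit Types L M N P Q A B C E F : lmodType R.

Lemma proper_idealP (I : set R) :
  proper_ideal_set I <-> submod (I : set R^o) /\ ~ I 1.
Proof.
split=> [[/set_mem I0 /negP I1 Ip]|[[I0 Ip] I1]].
  split; last by move=> /mem_set.
  by split=> // a x y Ix Iy; apply/set_mem/Ip; exact: mem_set.
split; first exact: mem_set.
  by apply/negP => /set_mem.
by move=> a x y /set_mem Ix /set_mem Iy; apply/mem_set/Ip.
Qed.

Lemma ideal_fg (I : set R^o) : submod I -> exists s : seq R^o, I = lin_span s.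
Proof.
move=> hI; case: (pselect (I 1)) => I1; last first.
  by have [|s ->] := R_noetherian (I := I); [apply/proper_idealP|exists s].
exists [:: (1 : R^o)]; apply/seteqP; split=> x _.
  by apply/lin_span_cons; exists x, 0; rewrite addr0 [x *: _]mulr1 lin_span_nil.
by rewrite -[x]mulr1; apply: (submodZ x hI I1).
Qed.

(** Choice along a list, where [choice] would need a function on the whole type. *)
Lemma choose_seq (T : eqType) (S : choiceType) (P : T -> S -> Prop) (s : seq T) :
  (forall a, a \in s -> exists b, P a b) ->
  exists t : seq S, size t = size s /\
    (forall x0 y0 i, (i < size s)%N -> P (nth x0 s i) (nth y0 t i)).
Proof.
elim: s => [|a s IH] h; first by exists [::].
have [b Pb] := h a (mem_head _ _).
have [t [et ht]] := IH (fun c hc => h c (mem_behead (s := a :: s) hc)).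
exists (b :: t); split=> /=; first by rewrite et.
by move=> x0 y0 [|i] //=; rewrite ltnS => /ht.
Qed.

(** The coefficients at the first generator of the elements of [U] form a finitely
    generated ideal; elements of [U] realizing its generators reduce the claim to
    the remaining generators. *)
Lemma span_sub_fg M (s : seq M) (U : set M) :
  submod U -> U `<=` lin_span s -> exists t : seq M, U = lin_span t.
Proof.
elim: s U => [|a s IH] U hU Us.
  exists [::]; apply/seteqP; split=> x; first exact: Us.
  by move/lin_span_nil->; case: hU.
pose I : set R^o := [set r | exists2 u, U u & lin_span s (u - (r : R) *: a)].
have hI : submod I.
  split; first by exists 0; [case: hU|rewrite scale0r subr0; case: (submod_span s)].
  move=> c r r' [u Uu su] [u' Uu' su']; exists (c *: u + u').
    by case: hU => _; apply.
  have -> : c *: u + u' - (c *: r + r' : R) *: a =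
            c *: (u - (r : R) *: a) + (u' - (r' : R) *: a).
    by rewrite scalerBr scalerDl scalerA opprD addrACA.
  by case: (submod_span s) => _; apply.
have [rs eI] := ideal_fg hI.
have [us [sz_us usP]] : exists us : seq M, size us = size rs /\
    forall (x0 : R^o) (y0 : M) i, (i < size rs)%N ->
      U (nth y0 us i) /\ lin_span s (nth y0 us i - (nth x0 rs i : R) *: a).
  apply: (@choose_seq R^o M (fun r u => U u /\ lin_span s (u - (r : R) *: a))).
  by move=> r /mem_span; rewrite -eI => -[u Uu su]; exists u.
have [|t et] := IH (U `&` lin_span s) _ (@subIsetr _ _ _).
  split; first by split; [case: hU|case: (submod_span s)].
  move=> c x y [Ux sx] [Uy sy]; split; first by case: hU => _; apply.
  by case: (submod_span s) => _; apply.
exists (us ++ t); apply/seteqP; split=> x.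
  move=> Ux; have /lin_span_cons[c [y [sy ex]]] := Us _ Ux.
  have : I c by exists x => //; rewrite ex addrC addKr.
  rewrite eI => -[e ec].
  pose w := \sum_(i < size rs) e i *: us`_i.
  have Uw : U w.
    apply: submod_sum => // i; apply: submodZ => //.
    by have [] := usP 0 0 i (ltn_ord i).
  have span_w : lin_span (us ++ t) w.
    apply: submod_sum; first exact: submod_span.
    move=> i; apply: submodZ; first exact: submod_span.
    by apply: mem_span; rewrite mem_cat mem_nth // sz_us.
  have sw : lin_span s (w - (c : R) *: a).
    rewrite ec scaler_suml -sumrB; apply: submod_sum; first exact: submod_span.
    move=> i; rewrite -[X in _ - X]scalerA -scalerBr.
    apply: submodZ; first exact: submod_span.
    by have [] := usP 0 0 i (ltn_ord i).
  have : (U `&` lin_span s) (x - w).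
    split; first exact: submodB.
    rewrite ex -[_ - w](_ : y - (w - c *: a) = _); last first.
      by rewrite opprB addrCA addrA.
    by apply: submodB => //; apply: submod_span.
  rewrite et => txw; rewrite -(subrK w x); apply: submodD => //.
    exact: submod_span.
  apply: span_min txw; first exact: submod_span.
  by move=> z tz; apply: mem_span; rewrite mem_cat tz orbT.
apply: span_min => // z; rewrite mem_cat => /orP[/(nthP 0)[i hi <-]|/mem_span].
  by have [] := usP 0 0 i; rewrite -?sz_us.
by rewrite -et => -[].
Qed.

Lemma submod_fg M (U : set M) : fin_gen M -> submod U -> exists t, U = lin_span t.
Proof. by case=> s es hU; apply: (@span_sub_fg _ s) => //; rewrite es. Qed.

Lemma submodule_fin_gen M (U : set M) (hU : submod U) : fin_gen M -> fin_gen (submodule hU).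
Proof.
move=> fgM; have [t et] := submod_fg fgM hU.
have [s [sz_s sP]] : exists s : seq (submodule hU), size s = size t /\
    forall (x0 : M) (y0 : submodule hU) i, (i < size t)%N ->
      nth x0 t i = submodule_incl hU (nth y0 s i).
  apply: (@choose_seq M (submodule hU) (fun a b => a = submodule_incl hU b)).
  by move=> a /mem_span; rewrite -et => /(submodule_incl_ex hU).
have ets : t = map (submodule_incl hU) s.
  apply: (@eq_from_nth _ 0); first by rewrite size_map.
  by move=> i it; rewrite (nth_map 0) ?sz_s // -(sP 0 0).
exists s; apply/seteqP; split=> // x _.
have : lin_span t (submodule_incl hU x) by rewrite -et; apply: submodule_inclP.
by rewrite ets => /span_map[y sy /(submodule_incl_inj hU) ->].
Qed.

Lemma fin_gen_inj M N (f : {linear M -> N}) : injective f -> fin_gen N -> fin_gen M.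
Proof.
move=> fi fgN; have hr := submod_range f.
have [g gE] := lift_along_inj (g := submodule_incl hr) fi (@submodule_inclP _ _ _ hr).
apply: (fin_gen_surj (f := g)) (submodule_fin_gen hr fgN) => x.
have [y ey] := submodule_incl_ex hr (ex_intro _ x (erefl (f x))).
by exists y; apply: fi; rewrite gE.
Qed.

Lemma fin_gen_ext L M N (f : {linear L -> M}) (g : {linear M -> N}) :
  short_exact f g -> fin_gen L -> fin_gen N -> fin_gen M.
Proof.
move=> [fi ex gs] [s es] [t et].
have [u [sz_u uP]] : exists u : seq M, size u = size t /\
    forall (x0 : N) (y0 : M) i, (i < size t)%N -> nth x0 t i = g (nth y0 u i).
  by apply: (@choose_seq N M (fun a b => a = g b)) => a _; apply: gs.
have etu : t = map g u.
  apply: (@eq_from_nth _ 0); first by rewrite size_map.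
  by move=> i it; rewrite (nth_map 0) ?sz_u // -(uP 0 0).
exists (map f s ++ u); apply/seteqP; split=> // x _.
have : lin_span t (g x) by rewrite et.
rewrite etu => /span_map[y uy gxy].
have /ex[z ez] : g (x - y) = 0 by rewrite linearB gxy subrr.
rewrite -(subrK y x); apply: submodD; first exact: submod_span.
  have : lin_span (map f s) (x - y).
    by apply/span_map; exists z => //; rewrite es.
  apply: span_min; first exact: submod_span.
  by move=> w sw; apply: mem_span; rewrite mem_cat sw.
move: uy; apply: span_min; first exact: submod_span.
by move=> w sw; apply: mem_span; rewrite mem_cat sw orbT.
Qed.

(** Otherwise a strictly increasing sequence of submodules would have a union that
    is not finitely generated. *)
Lemma submod_maximal M (P : set M -> Prop) U0 :
  fin_gen M -> submod U0 -> P U0 ->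
  exists U, [/\ submod U, P U & forall V, submod V -> P V -> U `<=` V -> V `<=` U].
Proof.
move=> fgM hU0 PU0; apply: contrapT => noMax.
pose T := {U : set M | submod U /\ P U}.
have step (U : T) : exists V : T, sval U `<=` sval V /\ ~ sval V `<=` sval U.
  case: U => U [hU PU] /=; apply: contrapT => h; apply: noMax; exists U.
  split=> // V hV PV UV; apply: contrapT => VU; apply: h.
  by exists (exist _ V (conj hV PV)).
have [f fP] := choice step.
pose C n := iter n f (exist _ U0 (conj hU0 PU0) : T).
have Cmono i j : (i <= j)%N -> sval (C i) `<=` sval (C j).
  elim: j => [|j IH]; first by rewrite leqn0 => /eqP ->.
  rewrite leq_eqVlt => /orP[/eqP ->//|]; rewrite ltnS => /IH h x /h Cx.
  by have [+ _] := fP (C j); apply.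
pose W := [set x | exists n, sval (C n) x].
have hC n : submod (sval (C n)) by case: (svalP (C n)).
have hW : submod W.
  split; first by exists 0%N; case: (hC 0%N).
  move=> a x y [i Cx] [j Cy]; exists (maxn i j).
  by case: (hC (maxn i j)) => _; apply;
     [apply: Cmono Cx; apply: leq_maxl|apply: Cmono Cy; apply: leq_maxr].
have [t et] := submod_fg fgM hW.
have [k tN] : exists k : nat, forall a, a \in t -> sval (C k) a.
  have : forall a, a \in t -> W a by move=> a; rewrite et; apply: mem_span.
  elim: (t) => [|a s IH] h; first by exists 0%N.
  have [i Ci] := h a (mem_head _ _).
  have [j Cj] := IH (fun b hb => h b (mem_behead (s := a :: s) hb)).
  exists (maxn i j) => b; rewrite inE => /orP[/eqP ->|/Cj].
    by apply: Cmono Ci; apply: leq_maxl.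
  by apply: Cmono; apply: leq_maxr.
have [_] := fP (C k); apply=> x Cx.
have : W x by exists k.+1.
by rewrite et; apply: span_min.
Qed.

End Noetherian.

(** * Free and projective modules *)

Section Free.
Variable R : comNzRingType.
Implicit Types L M N P Q A B C E F : lmodType R.

Fact from_free_linear M n (v : 'I_n -> M) :
  linear (fun a : 'rV[R]_n => \sum_(i < n) a 0 i *: v i).
Proof.
move=> c a b; rewrite scaler_sumr -big_split /=; apply: eq_bigr => i _.
by rewrite !mxE scalerDl scalerA.
Qed.

Definition from_free M n (v : 'I_n -> M) : {linear 'rV[R]_n -> M} :=
  mk_linear (from_free_linear v).

Fact to_free_linear M n (v : 'I_n -> {linear M -> R^o}) :
  linear (fun x => \row_(i < n) (v i x : R)).
Proof. by move=> c a b; apply/rowP => i; rewrite !mxE linearP. Qed.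

Definition to_free M n (v : 'I_n -> {linear M -> R^o}) : {linear M -> 'rV[R]_n} :=
  mk_linear (to_free_linear v).

Lemma to_freeE M n (v : 'I_n -> {linear M -> R^o}) x i : to_free v x 0 i = v i x.
Proof. by rewrite mk_linearE mxE. Qed.

Lemma from_free_delta M n (v : 'I_n -> M) i : from_free v (delta_mx 0 i) = v i.
Proof.
rewrite mk_linearE (bigD1 i) //= mxE !eqxx scale1r big1 ?addr0 // => j ji.
by rewrite mxE eqxx (negPf ji) scale0r.
Qed.

Lemma from_freeE M n (f : {linear 'rV[R]_n -> M}) a :
  f a = \sum_(i < n) a 0 i *: f (delta_mx 0 i).
Proof.
rewrite {1}[a]row_sum_delta linear_sum.
by apply: eq_bigr => i _; rewrite linearZ.
Qed.

Lemma free_ext M n (f g : {linear 'rV[R]_n -> M}) :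
  (forall i, f (delta_mx 0 i) = g (delta_mx 0 i)) -> forall a, f a = g a.
Proof.
by move=> h a; rewrite !from_freeE; apply: eq_bigr => i _; rewrite h.
Qed.

Fact coord_linear n (i : 'I_n) : linear (fun a : 'rV[R]_n => (a 0 i : R^o)).
Proof. by move=> c a b; rewrite !mxE. Qed.

Definition coord_map n (i : 'I_n) : {linear 'rV[R]_n -> R^o} :=
  mk_linear (coord_linear i).

(** Projectivity of [R^n], relative to the image of [p]. *)
Lemma free_lift n A B (p : {linear A -> B}) (g : {linear 'rV[R]_n -> B}) :
  (forall x, exists y, g x = p y) ->
  exists h : {linear 'rV[R]_n -> A}, forall x, p (h x) = g x.
Proof.
move=> gp; have [v vP] := choice (fun i : 'I_n => gp (delta_mx 0 i)).
exists (from_free v); apply: (@free_ext B n (p \o from_free v)) => i.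
by rewrite vP -[LHS]/(p (from_free v _)) from_free_delta.
Qed.

Lemma free_projective n : projective ('rV[R]_n).
Proof.
move=> A B g f gs; have [h hE] := free_lift (fun x => gs (f x)).
by exists h => x; rewrite hE.
Qed.

Lemma lin_span_free M (s : seq M) x :
  lin_span s x <-> exists a, x = from_free (fun i : 'I_(size s) => s`_i) a.
Proof.
split=> [[c ->]|[a ->]]; last by exists (fun i => a 0 i).
by exists (\row_i c i); apply: eq_bigr => i _; rewrite mxE.
Qed.

Lemma fin_gen_free M : fin_gen M ->
  exists n, exists f : {linear 'rV[R]_n -> M}, surjective_map f.
Proof.
case=> s es; exists (size s), (from_free (fun i => s`_i)) => x.
by apply/lin_span_free; rewrite es.
Qed.

Lemma free_fin_gen n : fin_gen ('rV[R]_n).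
Proof.
exists [seq delta_mx 0 i | i <- enum 'I_n]; apply/seteqP; split=> // a _.
rewrite [a]row_sum_delta; apply: submod_sum; first exact: submod_span.
move=> i; apply: submodZ; first exact: submod_span.
by apply/mem_span/map_f; rewrite mem_enum.
Qed.

Lemma free_fg_projective n : fg_projective ('rV[R]_n).
Proof. by split; [apply: free_fin_gen|apply: free_projective]. Qed.

Lemma ring_fin_gen : fin_gen (R^o : lmodType R).
Proof.
exists [:: (1 : R^o)]; apply/seteqP; split=> x _ //.
by apply/lin_span_cons; exists x, 0; rewrite addr0 [x *: _]mulr1 lin_span_nil.
Qed.

Lemma linear_ring M (f : {linear R^o -> M}) (a : R) : f a = a *: f 1.
Proof. by rewrite -linearZ; congr (f _); rewrite [RHS]mulr1. Qed.

Fact from_ring_linear M (x : M) : linear (fun a : R^o => (a : R) *: x).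
Proof. by move=> c a b; rewrite scalerDl -scalerA. Qed.

Definition from_ring M (x : M) : {linear R^o -> M} := mk_linear (from_ring_linear x).

Lemma ring_fg_projective : fg_projective (R^o : lmodType R).
Proof.
split; first exact: ring_fin_gen.
move=> A B g f gs; have [y ey] := gs (f 1).
exists (from_ring y) => x.
by rewrite mk_linearE [RHS]linearZ -ey [LHS]linear_ring.
Qed.

Lemma projective_retract P : fg_projective P ->
  exists n (i : {linear P -> 'rV[R]_n}) (r : {linear 'rV[R]_n -> P}),
    forall x, r (i x) = x.
Proof.
case=> /fin_gen_free[n [r rs]] Pproj.
have [i iE] := Pproj _ _ r idfun rs.
by exists n, i, r => x; rewrite -iE.
Qed.

End Free.

(** * Local rings and Nakayama's lemma *)

Section Local.
Variables (R : comNzRingType) (m : set R).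
Hypotheses (R_noetherian : noetherian_ring R) (R_local : local_ring m).
Implicit Types L M N P Q A B C E F : lmodType R.

Lemma max_ideal_submod : submod (m : set R^o).
Proof. by case: R_local => -[/proper_idealP[]]. Qed.

Lemma max_ideal_proper : ~ m 1.
Proof. by case: R_local => -[/proper_idealP[]]. Qed.

Lemma max_idealM (a x : R) : m x -> m (a * x).
Proof. exact: (submodZ a max_ideal_submod). Qed.

Lemma local_unit (x : R) : ~ m x -> exists y, y * x = 1.
Proof.
move=> mx; apply: contrapT => nu.
have hI := submod_range (from_ring (x : R^o)).
have [|U [hU [U1 xU] Umax]] := @submod_maximal _ R_noetherian R^o
    (fun V : set R^o => ~ V 1 /\ V x) _ (ring_fin_gen R) hI.
  split; last by exists 1; rewrite mk_linearE [RHS]mul1r.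
  by case=> y ey; apply: nu; exists y.
have /(proj2 R_local) eU : maximal_ideal U.
  split; first exact/proper_idealP.
  move=> V /proper_idealP[hV V1] UV; apply/seteqP; split=> //.
  by apply: Umax => //; split=> //; apply: UV.
by apply: mx; rewrite -eU.
Qed.

Lemma unit_of_one_minus (c : R) : m c -> exists u, u * (1 - c) = 1.
Proof.
move=> mc; apply: local_unit => m1c; apply: max_ideal_proper.
by rewrite -(subrK c 1); apply: (submodD max_ideal_submod m1c mc).
Qed.

(** The submodule [mN], for [N] spanned by [s]. *)
Fixpoint max_span M (s : seq M) : set M :=
  if s is a :: s' then
    [set x | exists c y, [/\ m c, max_span s' y & x = c *: a + y]]
  else [set 0].

Lemma submod_max_span M (s : seq M) : submod (max_span s).
Proof.
elim: s => [|a s [IH0 IH]] /=; first exact: submod_zero.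
split.
  exists 0, 0; split=> //; first by case: max_ideal_submod.
  by rewrite scale0r addr0.
move=> r _ _ [c [y [mc sy ->]]] [c' [y' [mc' sy' ->]]].
exists (r * c + c'), (r *: y + y'); split; last 1 first.
- by rewrite scalerDr scalerDl scalerA addrACA.
- by case: max_ideal_submod => _; apply.
- exact: IH.
Qed.

Lemma max_span_scale M (s : seq M) c z : m c -> lin_span s z -> max_span s (c *: z).
Proof.
move=> mc; elim: s z => [|a s IH] z.
  by move=> /lin_span_nil -> /=; rewrite scaler0.
case/lin_span_cons=> [r [y [sy ->]]] /=; exists (c * r), (c *: y); split.
- by rewrite mulrC; apply: max_idealM.
- exact: IH.
- by rewrite scalerDr scalerA.
Qed.

(** Nakayama's lemma relative to a submodule [B], for an explicit list of
    generators: each generator in turn is eliminated by inverting [1 - c]. *)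
Lemma nakayama_seq M (B : set M) (s : seq M) : submod B ->
  (forall g, g \in s -> exists2 z, max_span s z & B (g - z)) ->
  forall g, g \in s -> B g.
Proof.
move=> hB; elim: s => // a s IH h.
have [_ [c [y [mc sy ->]]] Ba] := h a (mem_head _ _).
have [u uE] := unit_of_one_minus mc.
have Ba' : B (a - u *: y).
  have -> : a - u *: y = u *: (a - (c *: a + y)).
    rewrite opprD addrA scalerBr; congr (_ - _).
    by rewrite -[X in X - _]scale1r -scalerBl scalerA uE scale1r.
  exact: submodZ.
have Bs g : g \in s -> B g.
  apply: IH => b bs.
  have [_ [c' [y' [mc' sy' ->]]] Bb] := h b (mem_behead (s := a :: s) bs).
  exists (c' *: (u *: y) + y').
    case: (submod_max_span s) => _; apply=> //.
    by apply: submodZ sy; apply: submod_max_span.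
  have -> : b - (c' *: (u *: y) + y') = (b - (c' *: a + y')) + c' *: (a - u *: y).
    rewrite scalerBr !opprD -!addrA; congr (_ + _).
    by rewrite [RHS]addrCA addKr addrC.
  by apply: submodD => //; apply: submodZ.
move=> g; rewrite inE => /orP[/eqP ->|/Bs //].
rewrite -(subrK (u *: y) a); apply: submodD => //; apply: submodZ => //.
elim: (s) y sy Bs {IH h Ba Ba'} => [|b t IHt] y /=; first by move=> -> _; case: hB.
case=> c' [y' [_ ty' ->]] Bs.
case: (hB) => _; apply; first by apply: Bs; rewrite mem_head.
by apply: IHt => // z zt; apply: Bs; rewrite inE zt orbT.
Qed.

Lemma nakayama M (W B : set M) : fin_gen M -> submod W -> submod B ->
  (forall w, W w -> exists c w', [/\ m c, W w' & B (w - c *: w')]) -> W `<=` B.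
Proof.
move=> fgM hW hB h; have [s es] := submod_fg R_noetherian fgM hW.
rewrite es; apply: span_min => //; apply: nakayama_seq => // g gs.
have [|c [w' [mc Ww' Bw]]] := h g; first by rewrite es; apply: mem_span.
by exists (c *: w') => //; apply: max_span_scale; rewrite -?es.
Qed.

End Local.

(** * Associated primes and regular elements *)

Section Depth.
Variables (R : comNzRingType) (m : set R).
Hypotheses (R_noetherian : noetherian_ring R) (R_local : local_ring m).
Implicit Types L M N P Q A B C E F : lmodType R.

Let hm : submod (m : set R^o) := max_ideal_submod R_local.

Definition colon M (U : set M) (e : M) : set R := [set a | U (a *: e)].

Lemma submod_colon M (U : set M) e : submod U -> submod (colon U e : set R^o).
Proof.
move=> hU; split=> [|a x y Ux Uy]; first by rewrite /colon /= scale0r; case: hU.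
by rewrite /colon /= scalerDl -scalerA; case: hU => _; apply.
Qed.

Lemma prime_idealP (p : set R) : prime_ideal p <->
  [/\ submod (p : set R^o), ~ p 1 & forall a b, p (a * b) -> p a \/ p b].
Proof.
split=> [[/proper_idealP[hp p1] pp]|[hp p1 pp]].
  by split=> // a b /mem_set /pp /orP[] /set_mem; [left|right].
split; first exact/proper_idealP.
by move=> a b /set_mem /pp[] h; apply/orP; [left|right]; apply/mem_set.
Qed.

(** An annihilator of an element of [M / U], maximal among those of elements of [W]
    outside [U], is prime: if [b] does not kill [w], then [b *: w] has the same
    annihilator as [w]. *)
Lemma maximal_annihilator M (W U : set M) (w0 : M) : submod U ->
  (forall a w, W w -> W (a *: w)) -> W w0 -> ~ U w0 ->
  exists w, [/\ W w, ~ U w, prime_ideal (colon U w) &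
    forall w', W w' -> ~ U w' -> colon U w `<=` colon U w' ->
      colon U w' `<=` colon U w].
Proof.
move=> hU WZ Ww0 Uw0.
have [|I [hI [w [Ww Uw eI]] Imax]] := @submod_maximal _ R_noetherian R^o
    (fun I => exists w, [/\ W w, ~ U w & I = colon U w]) _ (ring_fin_gen R)
    (submod_colon w0 hU).
  by exists w0.
have wmax w' : W w' -> ~ U w' -> colon U w `<=` colon U w' ->
    colon U w' `<=` colon U w.
  move=> Ww' Uw'; rewrite -eI; apply: Imax; first exact: submod_colon.
  by exists w'.
exists w; split=> //; apply/prime_idealP; split; first exact: submod_colon.
  by rewrite /colon /= scale1r.
move=> a b Uab; case: (pselect (colon U w b)) => Ub; [by right|left].
apply: (wmax (b *: w)) => //; first exact: WZ.
  by move=> c Uc; rewrite /colon /= scalerA mulrC -scalerA; apply: submodZ.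
by rewrite /colon /= scalerA.
Qed.

Lemma prime_avoid_list M (U : set M) (p : set R) (s : seq M) :
  prime_ideal p -> submod U ->
  (forall e, e \in s -> exists2 b, U (b *: e) & ~ p b) ->
  exists2 b, ~ p b & forall e, e \in s -> U (b *: e).
Proof.
move=> /prime_idealP[hp p1 pp] hU; elim: s => [|e s IH] h; first by exists 1.
have [b pb bs] := IH (fun e he => h e (mem_behead (s := _ :: s) he)).
have [c Uc pc] := h e (mem_head _ _).
exists (b * c) => [/pp[]//|x]; rewrite inE => /orP[/eqP ->|/bs Ub].
  by rewrite -scalerA; apply: submodZ.
by rewrite mulrC -scalerA; apply: submodZ.
Qed.

(** Quotients are represented by pairs: [x] is regular on [M / U].  Dividing by the
    terms of a regular sequence then only enlarges [U], inside a fixed module. *)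
Definition regular_mod M (U : set M) (x : R) : Prop := forall y, U (x *: y) -> U y.

Definition add_multiples M (U : set M) (x : R) : set M :=
  [set y | exists u z, U u /\ y = u + x *: z].

(** Prime avoidance over the maximal annihilators of elements of [M / U], of
    which there are finitely many because finitely many of the elements they
    annihilate span all the others. *)
Lemma regular_element_exists M (U : set M) : fin_gen M -> submod U ->
  (forall e, (forall a, m a -> U (a *: e)) -> U e) ->
  exists2 z, m z & regular_mod U z.
Proof.
move=> fgM hU nom.
pose T : set M := [set e | [/\ ~ U e, prime_ideal (colon U e) &
  forall e', ~ U e' -> colon U e `<=` colon U e' -> colon U e' `<=` colon U e]].
have [|V [hV [s sT eV] Vmax]] := @submod_maximal _ R_noetherian M
    (fun V => exists2 s : seq M, (forall e, e \in s -> T e) & V = lin_span s)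
    _ fgM (submod_span [::]).
  by exists [::].
have Ts e : T e -> lin_span s e.
  move=> Te; rewrite -eV; apply: (Vmax (lin_span (e :: s))).
  - exact: submod_span.
  - by exists (e :: s) => // x; rewrite inE => /orP[/eqP ->|/sT].
  - rewrite eV; apply: span_min; first exact: submod_span.
    by move=> a sa; apply: mem_span; rewrite inE sa orbT.
  - by apply: mem_span; rewrite mem_head.
have [z mz zs] : exists2 z, m z & forall e, e \in s -> ~ U (z *: e).
  elim: s sT {eV Vmax Ts} => [|e s IH] sT; first by exists 0 => //; case: hm.
  have [x mx xs] := IH (fun e he => sT e (mem_behead (s := _ :: s) he)).
  have [Ue pe emax] := sT e (mem_head _ _).
  case: (pselect (U (x *: e))) => Uxe; last first.
    by exists x => // y; rewrite inE => /orP[/eqP ->//|/xs].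
  have [b Ub bs] : exists2 b, ~ colon U e b & forall e', e' \in s -> U (b *: e').
    apply: prime_avoid_list => // e' e's; apply: contrapT => h.
    have [Ue' pe' e'max] := sT e' (mem_behead (s := _ :: s) e's).
    apply: (xs e' e's); apply: (e'max e Ue) => // a Ua.
    by apply: contrapT => Uae; apply: h; exists a.
  have [c mc Uc] : exists2 c, m c & ~ U (c *: e).
    apply: contrapT => h; apply: Ue; apply: nom => a ma.
    by apply: contrapT => Ua; apply: h; exists a.
  exists (x + c * b).
    by apply: (submodD hm mx); rewrite mulrC; apply: (submodZ b hm mc).
  move=> y; rewrite inE => /orP[/eqP ->|ys] Uy.
    have : colon U e (c * b).
      by rewrite /colon /= -[_ *: e](addKr (x *: e)) addrC -scalerDl; apply: submodB.
    by case/prime_idealP: pe => _ _ pp /pp[].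
  apply: (xs y ys); rewrite -[x](addrK (c * b)) scalerBl; apply: submodB => //.
  by rewrite -scalerA; apply: submodZ => //; apply: bs.
exists z => // y Uzy; apply: contrapT => Uy.
have [|w [Ww Uw pw wmax]] := @maximal_annihilator M
    [set w | colon U y `<=` colon U w] U y hU _ (@subset_refl _ _) Uy.
  move=> a w /= h b /h; rewrite /colon /= => Ubw.
  by rewrite scalerA mulrC -scalerA; apply: submodZ.
have Tw : T w.
  by split=> // e' Ue' we'; apply: wmax => //; apply: subset_trans we'.
have Uzw : colon U w z by apply: Ww.
have [b Ub bs] : exists2 b, ~ colon U w b & forall e', e' \in s -> U (b *: e').
  apply: prime_avoid_list => // e' e's; apply: contrapT => h.
  have [Ue' pe' e'max] := sT e' e's.
  apply: (zs e' e's); apply: (e'max w Uw) => // a Ua.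
  by apply: contrapT => Uaw; apply: h; exists a.
apply: Ub; have := Ts w Tw.
apply: (@span_min _ _ s [set x | U (b *: x)]); last exact: bs.
exact: (submod_preimage (scale_by M b) hU).
Qed.

Lemma submod_add_multiples M (U : set M) x : submod U -> submod (add_multiples U x).
Proof.
move=> hU; split=> [|a _ _ [u [z [Uu ->]]] [u' [z' [Uu' ->]]]].
  by exists 0, 0; split; [case: hU|rewrite scaler0 addr0].
exists (a *: u + u'), (a *: z + z'); split; first by case: hU => _; apply.
by rewrite !scalerDr !scalerA addrACA mulrC.
Qed.

Lemma add_multiples_sub M (U : set M) x : U `<=` add_multiples U x.
Proof. by move=> u Uu; exists u, 0; rewrite scaler0 addr0. Qed.

Lemma add_multiples_scale M (U : set M) x z : submod U -> add_multiples U x (x *: z).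
Proof. by move=> hU; exists 0, z; rewrite add0r; split=> //; case: hU. Qed.

Lemma add_multiplesC M (U : set M) x y :
  add_multiples (add_multiples U x) y = add_multiples (add_multiples U y) x.
Proof.
apply/seteqP; split=> _ [_ [z [[u [w [Uu ->]]] ->]]].
  by exists (u + y *: z), w; split; [exists u, z|rewrite addrAC].
by exists (u + x *: z), w; split; [exists u, z|rewrite addrAC].
Qed.

(** Exchanging the terms of a regular sequence [x, z]. *)
Lemma regular_mod_add_multiples M (U : set M) x z : submod U ->
  regular_mod U x -> regular_mod (add_multiples U x) z -> regular_mod (add_multiples U z) x.
Proof.
move=> hU xU zUx e [u [f [Uu e1]]].
have [|u' [g [Uu' ef]]] := zUx f.
  exists (- u), e; split; first exact: submodN.
  by rewrite e1 addKr.
exists (e - z *: g), g; split; last by rewrite subrK.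
apply: xU; rewrite scalerBr e1 ef scalerDr !scalerA [x * z]mulrC.
by rewrite -addrA addrK; apply: submodD => //; apply: submodZ.
Qed.

(** The depth of [M / U] is at least [n]; the zero module has infinite depth. *)
Fixpoint depth_ge M (n : nat) (U : set M) : Prop :=
  if n is n'.+1 then exists x,
    [/\ m x, regular_mod U x & depth_ge n' (add_multiples U x)] else True.

Lemma depth_geW M n (U : set M) : depth_ge n.+1 U -> depth_ge n U.
Proof.
elim: n U => // n IH U [x [mx xU dx]]; exists x; split=> //.
exact: IH.
Qed.

Lemma depth_ge_leq M n k (U : set M) : (k <= n)%N -> depth_ge n U -> depth_ge k U.
Proof.
elim: n => [|n IH]; first by rewrite leqn0 => /eqP ->.
by rewrite leq_eqVlt => /orP[/eqP ->//|]; rewrite ltnS => /IH h /depth_geW.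
Qed.

Lemma depth_ge_killed M n (U : set M) e :
  depth_ge n.+1 U -> (forall a, m a -> U (a *: e)) -> U e.
Proof. by case=> x [mx xU _] h; apply/xU/h. Qed.

Lemma regular_mod_prod M N (U : set M) (V : set N) z : submod U -> submod V ->
  regular_mod [set p : M * N | U p.1 /\ V p.2] z <-> regular_mod U z /\ regular_mod V z.
Proof.
move=> [U0 _] [V0 _]; split=> [h|[hU hV] p []]; last by split; [apply: hU|apply: hV].
split=> x Ux.
  by have [] := h (x, 0); rewrite //= scaler0.
by have [] := h (0, x); rewrite //= scaler0.
Qed.

Lemma common_regular M N n k (U : set M) (V : set N) :
  fin_gen M -> fin_gen N -> submod U -> submod V -> depth_ge n.+1 U -> depth_ge k.+1 V ->
  exists z, [/\ m z, regular_mod U z & regular_mod V z].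
Proof.
move=> fgM fgN hU hV dU dV.
have fgMN := fin_gen_ext (prod_exact M N) fgM fgN.
have [|z mz /(regular_mod_prod _ hU hV)[]] :=
    regular_element_exists fgMN (submod_prod hU hV); last by exists z.
move=> [x y] h; split; [apply: (depth_ge_killed dU)|apply: (depth_ge_killed dV)] => a /h;
  by case.
Qed.

(** Depth does not depend on the regular sequence: any regular element can be
    taken as its first term.  The elements of [m] kill no nonzero element of
    [M / (U + yM)] because they kill none of [M / (U + xM)], and a [z] regular on
    both quotients reduces the claim to smaller depth. *)
Lemma depth_ge_independent M n (U : set M) y : fin_gen M -> submod U ->
  depth_ge n.+1 U -> m y -> regular_mod U y -> depth_ge n (add_multiples U y).
Proof.
move=> fgM; elim: n U y => // n IH U y hU dU my yU.
have [x [mx xU dx]] := dU.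
have hUx := submod_add_multiples x hU; have hUy := submod_add_multiples y hU.
have dy e : (forall a, m a -> add_multiples U y (a *: e)) -> add_multiples U y e.
  move=> h; have [u [f [Uu e1]]] := h x mx.
  have [u' [g [Uu' ef]]] : add_multiples U x f.
    apply: (depth_ge_killed dx) => a ma; have [ua [ga [Uua e2]]] := h a ma.
    exists (a *: f - x *: ga), ga; split; last by rewrite subrK.
    have yf : y *: f = x *: e - u by rewrite e1 addrC addKr.
    apply: yU; rewrite scalerBr [y *: (a *: f)]scalerA [y * a]mulrC -scalerA yf.
    rewrite scalerBr [a *: (x *: e)]scalerA [a * x]mulrC -scalerA e2 scalerDr.
    rewrite [y *: (x *: ga)]scalerA [y * x]mulrC -scalerA addrAC addrK.
    by apply: submodB => //; apply: submodZ.
  exists (e - y *: g), g; split; last by rewrite subrK.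
  apply: xU; rewrite scalerBr e1 ef scalerDr !scalerA [x * y]mulrC.
  by rewrite -addrA addrK; apply: submodD => //; apply: submodZ.
have dy1 : depth_ge 1 (add_multiples U y).
  by have [z mz zr] := regular_element_exists fgM hUy dy; exists z.
have [z0 [mz0 z0x z0y]] := common_regular fgM fgM hUx hUy dx dy1.
have fgMM := fin_gen_ext (prod_exact M M) fgM fgM.
have dxy : depth_ge 1 [set p : M * M | add_multiples U x p.1 /\ add_multiples U y p.2].
  by exists z0; split=> //; apply/regular_mod_prod.
have [z [mz zU /(regular_mod_prod _ hUx hUy)[zx zy]]] :=
  common_regular fgM fgMM hU (submod_prod hUx hUy) dU dxy.
exists z; split=> //; rewrite add_multiplesC; apply: (IH) => //.
- exact: submod_add_multiples.
- exists x; split=> //; first exact: regular_mod_add_multiples.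
  by rewrite add_multiplesC; apply: IH.
- exact: regular_mod_add_multiples.
Qed.

End Depth.

(** * Depth and chains of primes *)

Section DepthDim.
Variables (R : comNzRingType) (m : set R).
Hypotheses (R_noetherian : noetherian_ring R) (R_local : local_ring m).
Implicit Types L M N P Q A B C E F : lmodType R.

Let hm : submod (m : set R^o) := max_ideal_submod R_local.

(** A regular sequence of length [n] on [M / U] bounds dimensions from below:
    a prime killing a nonzero element of [M / U] is contained in a larger one,
    containing the first term [x], that kills a nonzero element of
    [M / (U + xM)]. *)
Lemma depth_ge_prime_chain M n (U : set M) p e : fin_gen M -> submod U ->
  depth_ge m n U -> prime_ideal p -> ~ U e -> (forall a, p a -> U (a *: e)) ->
  exists2 c, prime_chain n c & c 0%N = p.
Proof.
move=> fgM; elim: n U p e => [|n IH] U p e hU.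
  move=> _ pp _ _; exists (fun _ => p) => //; split=> // i.
case=> x [mx xU dx] pp Ue pU.
pose W : set M := [set w | forall a, p a -> U (a *: w)].
have hW : submod W.
  split=> [a _|c y z Wy Wz a pa]; first by rewrite scaler0; case: hU.
  rewrite scalerDr scalerA mulrC -scalerA.
  by case: hU => _; apply; [apply: Wy|apply: Wz].
have hUx := submod_add_multiples x hU.
have [w Ww Uw] : exists2 w, W w & ~ add_multiples U x w.
  apply: contrapT => h; apply: Ue.
  apply: (nakayama R_noetherian R_local fgM hW hU _ pU) => w Ww.
  have [u [g [Uu ew]]] : add_multiples U x w by apply: contrapT => h'; apply: h; exists w.
  exists x, g; split=> //; last by rewrite ew addrK.
  move=> a pa; apply: xU; rewrite scalerA mulrC -scalerA.
  have -> : x *: g = w - u by rewrite ew addrC addKr.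
  by rewrite scalerBr; apply: submodB => //; [apply: Ww|apply: submodZ].
have [|w' [Ww' Uw' pw' _]] := maximal_annihilator R_noetherian hUx _ Ww Uw.
  by move=> a y Wy; apply: (submodZ a hW Wy).
have [c [cp cc] c0] := IH _ _ w' hUx dx pw' Uw' (fun a => id).
exists (fun i => if i is j.+1 then c j else p) => //; split=> [[|i]|[|i]] //.
- by rewrite ltnS => /cp.
- move=> _; rewrite c0; split=> [a pa|h].
    by apply: add_multiples_sub; apply: Ww'.
  apply: Ue; apply: xU; apply: pU; apply: h.
  exact: add_multiples_scale.
- by rewrite ltnS => /cc.
Qed.

Lemma depth_ge_krull M n d (U : set M) e : fin_gen M -> submod U ->
  krull_dim R d -> depth_ge m n U -> ~ U e -> (n <= d)%N.
Proof.
move=> fgM hU [_ kd] dU Ue.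
have [|w [_ Uw pw _]] := @maximal_annihilator _ R_noetherian M setT U e hU _ I Ue.
  by [].
have [c hc _] := depth_ge_prime_chain fgM hU dU pw Uw (fun a => id).
exact: kd hc.
Qed.

(** Otherwise an ideal maximal among those avoiding the multiplicative set of
    the [s * x ^+ n], with [s] outside [q], would be a prime strictly inside
    [q]. *)
Lemma minimal_prime_zero_divisor (q : set R) (x : R) : prime_ideal q ->
  (forall p, prime_ideal p -> p `<=` q -> q `<=` p) -> q x ->
  exists2 y, y <> 0 & x * y = 0.
Proof.
move=> pq qmin qx; have [hq q1 qp] := (prime_idealP q).1 pq.
have [[s [n [qs sx]]]|noZ] := pselect (exists s n, ~ q s /\ s * x ^+ n = 0).
  elim: n sx => [|n IH].
    by rewrite expr0 mulr1 => s0; case: qs; rewrite s0; case: hq.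
  case: (pselect (s * x ^+ n = 0)) => [/IH//|sn]; exists (s * x ^+ n) => //.
  by rewrite mulrCA -exprS.
pose avoid (V : set R^o) := forall s n, ~ q s -> ~ V (s * x ^+ n).
have [|V [hV Vav Vmax]] := submod_maximal R_noetherian (ring_fin_gen R)
    (submod_zero (R^o : lmodType R)) (P := avoid).
  by move=> s n qs s0; apply: noZ; exists s, n.
have meets (a : R) : ~ V a -> exists s n v r, [/\ ~ q s, V v & s * x ^+ n = v + r * a].
  move=> Va; apply: contrapT => h; apply: Va.
  have hVa : submod (add_multiples V a) := submod_add_multiples (a : R) hV.
  apply: (Vmax _ hVa).
  - move=> s n qs [v [r [Vv e]]]; apply: h; exists s, n, v, r; split=> //.
    by rewrite e; congr (_ + _); apply: mulrC.
  - exact: add_multiples_sub.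
  - by rewrite -[X in add_multiples V a X]mulr1; apply: add_multiples_scale.
have pV : prime_ideal V.
  apply/prime_idealP; split=> //.
    by move=> V1; apply: (Vav 1 0%N) => //; rewrite expr0 mulr1.
  move=> a b Vab; case: (pselect (V a)) => [|Va]; [by left|right].
  apply: contrapT => Vb.
  have [s [n [v [r [qs Vv e]]]]] := meets a Va.
  have [s' [n' [v' [r' [qs' Vv' e']]]]] := meets b Vb.
  apply: (Vav (s * s') (n + n')%N); first by case/qp.
  have VZ (c y : R) : V y -> V (c * y) by move=> Vy; apply: (submodZ c hV Vy).
  rewrite exprD mulrACA e e' mulrDl; apply: (submodD hV).
    by rewrite mulrC; apply: VZ.
  rewrite mulrDr; apply: (submodD hV); first exact: VZ.
  by rewrite mulrACA; apply: VZ.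
have Vq : V `<=` q.
  move=> s Vs; apply: contrapT => qs; apply: (Vav s 0%N qs).
  by rewrite expr0 mulr1.
case: (Vav 1 1%N q1); rewrite mul1r expr1.
exact: (qmin V pV Vq).
Qed.

(** A prime killing a nonzero element of a module of depth [d = dim R] is minimal,
    by the length of the chains above it. *)
Lemma regular_mod_max_depth M d (U : set M) x : fin_gen M -> submod U ->
  krull_dim R d -> depth_ge m d U -> (forall y, x * y = 0 -> y = 0) -> regular_mod U x.
Proof.
move=> fgM hU [_ kd] dU xR y Uxy; apply: contrapT => Uy.
have [|w [Ww Uw pw _]] := @maximal_annihilator _ R_noetherian M
    [set w | U (x *: w)] U y hU _ Uxy Uy.
  by move=> a w /= Uw; rewrite scalerA mulrC -scalerA; apply: submodZ.
have [c [cp cc] c0] := depth_ge_prime_chain fgM hU dU pw Uw (fun a => id).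
have [|z z0 /xR//] := @minimal_prime_zero_divisor _ x pw _ Ww.
move=> p pp pq; apply: contrapT => qp.
have /kd : prime_chain d.+1 (fun i => if i is j.+1 then c j else p).
  split=> [[|i]|[|i]] //.
  - by rewrite ltnS => /cp.
  - by rewrite c0.
  - by rewrite ltnS => /cc.
by rewrite ltnn.
Qed.

(** ** Depth in exact sequences *)

(** A sequence [L -> M -> N -> 0] and a submodule [U] of [M] define an exact sequence
    [0 -> L / f^-1 U -> M / U -> N / g U -> 0]. *)

Section Exact.
Variables (L M N : lmodType R) (f : {linear L -> M}) (g : {linear M -> N}).
Hypotheses (ex : exact_at f g) (gs : surjective_map g).
Variables (U : set M) (hU : submod U) (x : R).

Lemma regular_mod_preimage : regular_mod U x -> regular_mod (f @^-1` U) x.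
Proof. by move=> xU y; rewrite /preimage /= linearZZ => /xU. Qed.

Lemma image_add_multiples : g @` add_multiples U x = add_multiples (g @` U) x.
Proof.
apply/seteqP; split=> y.
  case=> _ [u [z [Uu ->]]] <-; rewrite linearD linearZZ.
  by exists (g u), (g z); split=> //; exists u.
case=> _ [z [[u Uu <-] ->]]; have [z' ->] := gs z.
by exists (u + x *: z'); [exists u, z'|rewrite linearD linearZZ].
Qed.

Lemma preimage_add_multiples : regular_mod (g @` U) x ->
  f @^-1` (add_multiples U x) = add_multiples (f @^-1` U) x.
Proof.
move=> xg; apply/seteqP; split=> l.
  case=> u [z [Uu e]].
  have [u' Uu' egu] : (g @` U) (g z).
    apply: xg; exists (- u); first exact: submodN.
    have : g (f l) = 0 by apply/ex; exists l.
    by rewrite e linearD linearZZ linearN => /eqP; rewrite addr_eq0 => /eqP ->;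
       rewrite opprK.
  have /ex[l' el'] : g (z - u') = 0 by rewrite linearB egu subrr.
  exists (l - x *: l'), l'; split; last by rewrite subrK.
  rewrite /preimage /= linearB linearZZ -el' e scalerBr opprB.
  by rewrite [X in _ + _ + X]addrC addrA addrK; apply: submodD => //; apply: submodZ.
case=> u [z [Uu ->]]; exists (f u), (f z); split=> //.
by rewrite linearD linearZZ.
Qed.

Lemma regular_mod_exact : regular_mod (f @^-1` U) x -> regular_mod (g @` U) x ->
  regular_mod U x.
Proof.
move=> xf xg y Uxy.
have [|u Uu eu] := xg (g y); first by exists (x *: y) => //; rewrite linearZZ.
have /ex[l el] : g (y - u) = 0 by rewrite linearB eu subrr.
rewrite -(subrK u y); apply: submodD => //; rewrite el; apply: xf.
by rewrite /preimage /= linearZZ -el scalerBr; apply: submodB => //; apply: submodZ.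
Qed.
End Exact.

(** Choose [x] regular on both outer modules, and divide all three by it. *)
Lemma depth_ge_ext L M N (f : {linear L -> M}) (g : {linear M -> N}) n (U : set M) :
  exact_at f g -> surjective_map g -> fin_gen L -> fin_gen M -> submod U ->
  depth_ge m n (f @^-1` U) -> depth_ge m n (g @` U) -> depth_ge m n U.
Proof.
move=> ex gs fgL fgM; elim: n U => // n IH U hU df dg.
have fgN := fin_gen_surj gs fgM.
have hf := submod_preimage f hU; have hg := submod_image g hU.
have [x [mx xf xg]] := common_regular R_noetherian R_local fgL fgN hf hg df dg.
exists x; split=> //; first by move=> y; apply: (regular_mod_exact ex hU xf xg).
apply: IH; first exact: submod_add_multiples.
  rewrite (preimage_add_multiples ex hU xg).
  exact: (depth_ge_independent R_noetherian R_local).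
by rewrite (image_add_multiples gs); apply: (depth_ge_independent R_noetherian R_local).
Qed.

Lemma depth_ge_ker L M N (f : {linear L -> M}) (g : {linear M -> N}) n (U : set M) :
  exact_at f g -> surjective_map g -> fin_gen M -> submod U ->
  depth_ge m n.+1 U -> depth_ge m n (g @` U) -> depth_ge m n.+1 (f @^-1` U).
Proof.
move=> ex gs fgM; elim: n U => [|n IH] U hU dU dg.
  by case: dU => x [mx xU _]; exists x; split=> //; apply: regular_mod_preimage.
have fgN := fin_gen_surj gs fgM; have hg := submod_image g hU.
have [x [mx xU xg]] := common_regular R_noetherian R_local fgM fgN hU hg dU dg.
exists x; split=> //; first exact: regular_mod_preimage.
rewrite -(preimage_add_multiples ex hU xg); apply: IH; first exact: submod_add_multiples.
  exact: (depth_ge_independent R_noetherian R_local).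
by rewrite (image_add_multiples gs); apply: (depth_ge_independent R_noetherian R_local).
Qed.

Lemma depth_ge_retract A B (i : {linear A -> B}) (r : {linear B -> A}) n (U : set B) :
  (forall a, r (i a) = a) -> submod U -> (forall u, U u -> U (i (r u))) ->
  depth_ge m n U -> depth_ge m n (i @^-1` U).
Proof.
move=> ri; elim: n U => // n IH U hU Ur [x [mx xU dx]].
exists x; split=> //; first exact: regular_mod_preimage.
have <- : i @^-1` add_multiples U x = add_multiples (i @^-1` U) x.
  apply/seteqP; split=> a.
    case=> u [b [Uu e]]; exists (r u), (r b); split; first exact: Ur.
    by rewrite -[a]ri e linearD linearZZ.
  by case=> u [b [Uu ->]]; exists (i u), (i b); rewrite linearD linearZZ.
apply: IH => //; first exact: submod_add_multiples.
move=> _ [u [b [Uu ->]]]; rewrite !(linearD, linearZZ).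
by exists (i (r u)), (i (r b)); split=> //; apply: Ur.
Qed.

(** The submodule [U^k] of [R^k], so that [R^k / U^k = (R / U)^k]. *)
Definition free_submod k (U : set R^o) : set 'rV[R]_k := [set v | forall j, U (v 0 j)].

Lemma add_multiples_free k (U : set R^o) x :
  add_multiples (@free_submod k U) x = free_submod (add_multiples U x).
Proof.
apply/seteqP; split=> v.
  case=> u [z [Uu ->]] j; exists (u 0 j), (z 0 j); split=> //.
  by rewrite !mxE.
move=> /choice[u uP]; have [z zP] := choice uP.
exists (\row_j u j), (\row_j z j); split=> [j|]; first by rewrite mxE; case: (zP j).
by apply/rowP => j; rewrite !mxE; case: (zP j).
Qed.

Lemma regular_mod_free k (U : set R^o) x : regular_mod U x ->
  regular_mod (@free_submod k U) x.
Proof. by move=> xU v Uv j; apply: xU; have := Uv j; rewrite !mxE. Qed.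

Lemma depth_ge_free k n (U : set R^o) : depth_ge m n U -> depth_ge m n (@free_submod k U).
Proof.
elim: n U => // n IH U [x [mx xU dx]]; exists x; split=> //.
  exact: regular_mod_free.
by rewrite add_multiples_free; apply: IH.
Qed.

Lemma free_submod0 k : @free_submod k [set 0] = [set 0].
Proof.
apply/seteqP; split=> [v h|v -> j]; last by rewrite !mxE.
by apply/rowP => j; rewrite h mxE.
Qed.

(** ** Regular sequences and maximal Cohen--Macaulay modules *)

Fixpoint add_multiples_seq M (s : seq R) (U : set M) : set M :=
  if s is x :: s' then add_multiples_seq s' (add_multiples U x) else U.

Fixpoint regular_seq_mod M (s : seq R) (U : set M) : Prop :=
  if s is x :: s' then [/\ m x,
    regular_mod U x & regular_seq_mod s' (add_multiples U x)] else True.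

Lemma depth_geP M n (U : set M) : depth_ge m n U <->
  exists2 s, size s = n & regular_seq_mod s U.
Proof.
elim: n U => [|n IH] U; first by split=> // _; exists [::].
split=> [[x [mx xU /IH[s sz_s rs]]]|[[//|x s] [sz_s] [mx xU rs]]].
  by exists (x :: s) => //=; rewrite sz_s.
by exists x; split=> //; apply/IH; exists s.
Qed.

Lemma submod_add_multiples_seq M s (U : set M) : submod U -> submod (add_multiples_seq s U).
Proof. by elim: s U => //= x s IH U hU; apply/IH/submod_add_multiples. Qed.

Lemma ideal_mul_nil M : @ideal_mul R [::] M = [set 0].
Proof.
apply/seteqP; split=> y; first by case=> z ->; rewrite big_ord0.
by move->; exists (fun _ => 0); rewrite big_ord0.
Qed.

Lemma ideal_mul_rcons M s x : @ideal_mul R (rcons s x) M =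
  add_multiples (@ideal_mul R s M) x.
Proof.
apply/seteqP; split=> y.
  case=> z ->; move: z; rewrite size_rcons => z; rewrite big_ord_recr /=.
  rewrite nth_rcons ltnn eqxx.
  exists (\sum_(i < size s) s`_i *: z (widen_ord (leqnSn _) i)), (z ord_max).
  split; first by exists (fun i => z (widen_ord (leqnSn _) i)).
  by congr (_ + _); apply: eq_bigr => i _; rewrite nth_rcons ltn_ord.
case=> _ [w [[z ->] ->]].
exists (fun i : 'I_(size (rcons s x)) =>
          if insub (val i) is Some j then z j else w).
rewrite size_rcons big_ord_recr /= nth_rcons ltnn eqxx insubF ?ltnn //.
congr (_ + _); apply: eq_bigr => i _.
by rewrite nth_rcons ltn_ord valK.
Qed.

Lemma add_multiples_rcons M s x (U : set M) :
  add_multiples_seq (rcons s x) U = add_multiples (add_multiples_seq s U) x.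
Proof. by elim: s U => //= y s IH U; rewrite IH. Qed.

Lemma add_multiples_ideal_mul M s : add_multiples_seq s [set 0] = @ideal_mul R s M.
Proof.
elim/last_ind: s => [|s x IH]; first by rewrite ideal_mul_nil.
by rewrite add_multiples_rcons ideal_mul_rcons IH.
Qed.

Lemma regular_seq_mod_rcons M s x (U : set M) :
  regular_seq_mod (rcons s x) U <->
    [/\ regular_seq_mod s U, m x & regular_mod (add_multiples_seq s U) x].
Proof.
elim: s U => /= [|y s IH] U; first by split=> -[].
by split=> [[my yU /IH[rs mx xU]]|[[my yU rs] mx xU]]; split=> //; apply/IH.
Qed.

Lemma regular_seqP M s : regular_seq m M s <->
  regular_seq_mod s ([set 0] : set M) /\ exists y, ~ @ideal_mul R s M y.
Proof.
have H : regular_seq_mod s ([set 0] : set M) <-> (forall i, (i < size s)%N -> m s`_i) /\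
   (forall i, (i < size s)%N -> forall y : M,
        @ideal_mul R (take i s) M (s`_i *: y) -> @ideal_mul R (take i s) M y).
  elim/last_ind: s => [|s x IH]; first by split.
  apply: (iff_trans (regular_seq_mod_rcons s x _));
    rewrite add_multiples_ideal_mul size_rcons; split.
    case=> /IH[ms rs] mx rx; split=> i; rewrite ltnS leq_eqVlt => /orP[/eqP ->|li].
    - by rewrite nth_rcons ltnn eqxx.
    - by rewrite nth_rcons li; apply: ms.
    - by rewrite nth_rcons ltnn eqxx -cats1 take_size_cat.
    - by rewrite nth_rcons li -cats1 takel_cat ?(ltnW li) //; apply: rs.
  case=> ms rs; split; first (apply/IH; split).
  - by move=> i li; have := ms i (ltnW li); rewrite nth_rcons li.
  - move=> i li; have := rs i (ltnW li).
    by rewrite nth_rcons li -cats1 takel_cat ?(ltnW li).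
  - by have := ms (size s) (leqnn _); rewrite nth_rcons ltnn eqxx.
  - have := rs (size s) (leqnn _).
    by rewrite nth_rcons ltnn eqxx -cats1 take_size_cat.
by split=> [[ms rs ys]|[/H[]]]; [split=> //; apply/H|split].
Qed.

Lemma ideal_mul_proper M s (x : M) : fin_gen M ->
  (forall i, (i < size s)%N -> m s`_i) -> x <> 0 -> exists y, ~ @ideal_mul R s M y.
Proof.
move=> [g eg] ms x0; apply: contrapT => all_in; apply: x0.
have : lin_span g x by rewrite eg.
apply: span_min (submod_zero M) _ x.
apply: (nakayama_seq R_noetherian R_local (submod_zero M)) => a _.
exists a; last by rewrite subrr.
have [z ->] : @ideal_mul R s M a.
  by apply: contrapT => h; apply: all_in; exists a.
apply: submod_sum; first exact: (submod_max_span R_local).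
move=> i; apply: (max_span_scale R_local); first exact: ms.
by rewrite eg.
Qed.

Lemma krull_dim_uniq d d' : krull_dim R d -> krull_dim R d' -> d = d'.
Proof.
move=> [[p hp] h] [[p' hp'] h']; apply/eqP.
by rewrite eqn_leq (h' _ _ hp) (h _ _ hp').
Qed.

(** Unlike [depth], this covers the zero module uniformly. *)
Definition MCM d M := fin_gen M /\ depth_ge m d ([set 0] : set M).

Lemma maximal_CM_MCM d M : krull_dim R d -> maximal_CM m M <-> MCM d M.
Proof.
move=> hd; split=> -[fgM H]; split=> //.
  case: H => [M0|[n [/(krull_dim_uniq hd) <- [[s [/regular_seqP[rs _] sz_s]] _]]]].
    elim: (d) => // n IH; exists 0; split; [by case: hm|by move=> y _; apply: M0|].
    have -> // : add_multiples ([set 0] : set M) 0 = [set 0].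
    by apply/seteqP; split=> [x _|x ->]; [apply: M0|apply: add_multiples_sub].
  by apply/depth_geP; exists s.
case: (pselect (zero_module M)) => [M0|/existsNP[x x0]]; [by left|right].
exists d; split=> //; split.
  have [s sz_s rs] := (depth_geP _ _).1 H; exists s; split=> //.
  apply/regular_seqP; split=> //; apply: ideal_mul_proper x0 => //.
  elim: s {sz_s} ([set 0] : set M) rs {H} => //= y s IH U [my _ rs] [|i] //.
  by rewrite ltnS; apply: (IH _ rs).
move=> s /regular_seqP[rs _]; apply: (depth_ge_krull fgM (submod_zero M) hd _ x0).
by apply/depth_geP; exists s.
Qed.

End DepthDim.

(** * Duals, first extension groups and free resolutions *)

Section Ext1.
Variable R : comNzRingType.
Implicit Types L M N P Q A B C E F Y : lmodType R.

Fact hom_of_subproof M N (f : {linear M -> N}) : (f : M -> N) \in @is_linear R M N.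
Proof. by apply/asboolP => a x y; rewrite linearP. Qed.

Definition hom_of M N (f : {linear M -> N}) : hom_mod M N := HomMod (hom_of_subproof f).

Fact hom_mod_linear M N (h : hom_mod M N) : linear (h : M -> N).
Proof. by case: h => h /= /asboolP. Qed.

Definition map_of M N (h : hom_mod M N) : {linear M -> N} := mk_linear (hom_mod_linear h).

Lemma hom_modP M N (h h' : hom_mod M N) : (forall x, h x = h' x) -> h = h'.
Proof. by move=> e; apply: val_inj; apply/funext. Qed.

Lemma hom_modZ M N a (h : hom_mod M N) x : (a *: h) x = a *: h x.
Proof. by []. Qed.

Fact eval_linear M N (x : M) : linear (fun h : hom_mod M N => h x).
Proof. by []. Qed.

Definition eval_at M N (x : M) : {linear hom_mod M N -> N} :=
  mk_linear (@eval_linear M N x).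

Lemma hom_mod_sum M N n (h : 'I_n -> hom_mod M N) x :
  (\sum_(i < n) h i) x = \sum_(i < n) h i x.
Proof. exact: (linear_sum (eval_at N x)). Qed.

Fact precomp_linear L M N (f : {linear L -> M}) :
  linear (fun h : hom_mod M N => hom_of (map_of h \o f)).
Proof. by move=> a h h'; apply: hom_modP. Qed.

Definition precomp L M N (f : {linear L -> M}) : {linear hom_mod M N -> hom_mod L N} :=
  mk_linear (precomp_linear (N := N) f).

Lemma dual_fin_gen M : noetherian_ring R -> fin_gen M -> fin_gen (dual_module M).
Proof.
move=> R_noetherian /fin_gen_free[n [p ps]].
apply: (@fin_gen_inj _ R_noetherian _ _
  (to_free (fun i : 'I_n => eval_at R^o (p (delta_mx 0 i))))); last first.
  exact: free_fin_gen.
move=> h h' e; apply: hom_modP => x; have [a ->] := ps x.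
rewrite -[h _]/((map_of h \o p) a) -[h' _]/((map_of h' \o p) a); apply: free_ext => i.
by have /rowP/(_ i) := e; rewrite !to_freeE.
Qed.

(** [Ext^1(N, B) = 0], stated without choosing a resolution: every map to [B]
    extends along every injection with cokernel [N]. *)
Definition ext1 N B : Prop :=
  forall A A' (i : {linear A -> A'}) (q : {linear A' -> N}), short_exact i q ->
    forall g : {linear A -> B}, exists h : {linear A' -> B}, forall x, h (i x) = g x.

(** The pushout argument: [A'] is covered by [A * F], with kernel [Y]. *)
Lemma ext1_presentation Y F N B (j : {linear Y -> F}) (p : {linear F -> N}) :
  projective F -> short_exact j p ->
  (forall g : {linear Y -> B}, exists h : {linear F -> B}, forall x, h (j x) = g x) ->
  ext1 N B.
Proof.
move=> Fproj [ji jp ps] jext A A' i q [ii iq qs] g.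
have [u uE] := Fproj _ _ q p qs.
have [v vE] : exists v : {linear Y -> A}, forall y, i (v y) = (u \o j) y.
  apply: lift_along_inj => // y; apply/iq; rewrite -[_ y]/(u (j y)) -uE.
  by apply/jp; exists y.
have [t tE] := jext (g \o v).
have [||y|h hP] := @linear_of_relation R A' B
   (fun a b => exists x c, a = u x + i c /\ b = t x + g c).
- move=> a; have [x px] := ps (q a).
  have /iq[c ec] : q (a - u x) = 0 by rewrite linearB -uE px subrr.
  by exists (t x + g c), x, c; rewrite -ec addrC subrK.
- move=> r _ _ _ _ [x [c [-> ->]]] [x' [c' [-> ->]]].
  exists (r *: x + x'), (r *: c + c'); rewrite !linearP.
  by rewrite !scalerDr; split; rewrite addrACA.
- case=> x [c [e ->]].
  have /jp[y' ey] : p x = 0.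
    have : q (u x + i c) = 0 by rewrite -e linear0.
    rewrite linearD -uE (_ : q (i c) = 0) ?addr0 //.
    by apply/iq; exists c.
  have -> : c = - v y'.
    apply: ii; apply/eqP; rewrite linearN vE -addr_eq0 addrC -[_ y']/(u (j y')).
    by rewrite -ey -e.
  by rewrite ey tE -[_ y']/(g (v y')) linearN subrr.
exists h => x; apply/hP; exists 0, x.
by rewrite !linear0 !add0r.
Qed.

(** A free resolution spliced from short exact sequences has acyclic dual when
    maps to [R] extend along the inclusion of each syzygy. *)
Lemma Ext_zero_splice (S : nat -> lmodType R) (n : nat -> nat)
    (j : forall k, {linear S k.+1 -> 'rV[R]_(n k)})
    (p : forall k, {linear 'rV[R]_(n k) -> S k}) i :
  (forall k, short_exact (j k) (p k)) ->
  (forall k (g : {linear S k.+1 -> R^o}),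
      exists h : {linear 'rV[R]_(n k) -> R^o}, forall x, h (j k x) = g x) ->
  (0 < i)%N -> Ext_zero i (S 0%N) R^o.
Proof.
move=> ex je.
pose d k : {linear 'rV[R]_(n k.+1) -> 'rV[R]_(n k)} := j k \o p k.+1.
have dj k x : d k x = j k (p k.+1 x) by [].
have ps k : surjective_map (p k) by case: (ex k).
have ji k : injective (j k) by case: (ex k).
have jp k : exact_at (j k) (p k) by case: (ex k).
have ex0 : exact_at (d 0%N) (p 0%N).
  move=> y; split=> [/jp[z ->]|[x ->]].
    by have [x ->] := ps _ z; exists x.
  by apply/jp; exists (p 1%N x).
have exS k : exact_at (d k.+1) (d k).
  move=> y; split=> [|[x ->]].
    rewrite dj -[RHS](linear0 (j k)) => /ji /jp[z ->].
    by have [x ->] := ps _ z; exists x.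
  rewrite !dj (_ : p _ (j _ _) = 0) ?linear0 //.
  by apply/jp; exists (p k.+2 x).
case: i => // i _.
exists (@ProjectiveResolution R (S 0%N) (fun k => 'rV[R]_(n k)) d (p 0%N)
  (fun k => @free_projective R (n k)) (ps 0%N) ex0 exS) => phi cphi.
have [g gE] : exists g : {linear S i.+1 -> R^o}, forall x, g (p i.+1 x) = phi x.
  apply: factor_through_surj; first exact: ps.
  move=> x /jp[z ->]; have [y ->] := ps _ z; exact: (cphi y).
have [h hE] := je i g.
by exists h => x; rewrite -gE -hE.
Qed.

(** The class [K] provides the syzygies, by dependent choice. *)
Lemma Ext_zero_class (K : lmodType R -> Prop) :
  (forall N, K N -> exists n Y (j : {linear Y -> 'rV[R]_n}) (p : {linear 'rV[R]_n -> N}),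
    [/\ short_exact j p, K Y & forall g : {linear Y -> R^o},
        exists h : {linear 'rV[R]_n -> R^o}, forall x, h (j x) = g x]) ->
  forall N i, K N -> (0 < i)%N -> Ext_zero i N R^o.
Proof.
move=> res N i KN i0.
pose T := {N | K N}.
pose good (S S' : T) n (j : {linear sval S' -> 'rV[R]_n})
  (p : {linear 'rV[R]_n -> sval S}) :=
  short_exact j p /\ forall g : {linear sval S' -> R^o},
        exists h : {linear 'rV[R]_n -> R^o}, forall x, h (j x) = g x.
have /choice[nx nxP] : forall S : T, exists S' : T, exists n j p, @good S S' n j p.
  move=> [S KS]; have [n [Y [j [p [ex KY je]]]]] := res _ KS.
  by exists (exist _ Y KY), n, j, p.
pose syz k : T := iter k nx (exist _ N KN).
have {nxP} step k : exists n j p, @good (syz k) (syz k.+1) n j p := nxP (syz k).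
have [syz0 _] : sval (syz 0%N) = N /\ True by [].
move: syz step syz0 => syz step <-.
have [n nP] := choice step.
pose j k := sval (cid (nP k)).
pose p k := sval (cid (svalP (cid (nP k)))).
have jp k : good _ _ _ (j k) (p k) := svalP (cid (svalP (cid (nP k)))).
apply: (@Ext_zero_splice (fun k => sval (syz k)) n j p) => // k.
  by case: (jp k).
by case: (jp k).
Qed.

End Ext1.

Section MinimalApproximation.
Variables (R : comNzRingType) (m : set R).
Hypotheses (R_noetherian : noetherian_ring R) (R_local : local_ring m).
Implicit Types L M N P Q A B C E F : lmodType R.

(** A unit coefficient in a relation between the generators would make one of them
    redundant, so a shortest list of generators will do. *)
Lemma minimal_generators M : fin_gen M ->
  exists2 s : seq M, lin_span s = setT &
    forall c : 'I_(size s) -> R, \sum_(i < size s) c i *: s`_i = 0 -> forall i, m (c i).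
Proof.
case=> s0 es0.
pose P n := `[< exists2 s : seq M, lin_span s = setT & size s = n >].
have exP : exists n, P n by exists (size s0); apply/asboolP; exists s0.
case: (ex_minnP exP) => n /asboolP[s es sz_s] nmin; exists s => // c c0 i.
apply: contrapT => /(local_unit R_noetherian R_local)[u uc].
have := nmin (size s).-1; rewrite -sz_s.
have spos : (0 < size s)%N by apply: leq_ltn_trans (ltn_ord i).
have -> : P (size s).-1; last by move=> /(_ isT); rewrite leqNgt prednK // leqnn.
pose t := take i s ++ drop i.+1 s; apply/asboolP; exists t; last first.
  by rewrite size_cat size_takel ?size_drop; [rewrite -[in RHS](subnKC (ltn_ord i))
    |apply: ltnW].
have st (k : 'I_(size s)) : k != i -> s`_k \in t.
  rewrite mem_cat neq_ltn => /orP[ki|ik].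
    by rewrite -(nth_take 0 ki) mem_nth // size_takel // ltnW // ltn_ord.
  apply/orP; right; rewrite -(subnKC ik) -nth_drop mem_nth //.
  by rewrite size_drop; exact: (ltn_sub2r (leq_ltn_trans ik (ltn_ord k)) (ltn_ord k)).
apply/seteqP; split=> // x _; have : lin_span s x by rewrite es.
apply: span_min; first exact: submod_span.
move=> a /(nthP 0)[k sk <-]; have [e|ki] := eqVneq (Ordinal sk) i; last first.
  by apply: mem_span; apply: (st (Ordinal sk)).
have -> : s`_k = - (u *: \sum_(j < size s | j != i) c j *: s`_j).
  apply/eqP; rewrite -addr_eq0 -[X in X + _]scale1r -uc -scalerA -scalerDr.
  by move: c0; rewrite (bigD1 i) //= -e /= => ->; rewrite scaler0.
apply: submodN; first exact: submod_span.
apply: submodZ; first exact: submod_span.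
apply: big_ind => [|y z|j ji].
- by case: (submod_span t).
- by apply: submodD; apply: submod_span.
- by apply: submodZ; [apply: submod_span|apply/mem_span/st].
Qed.

(** The map given by minimal generators of the dual.  An endomorphism [g] with
    [g f = f] is the identity modulo [m] by minimality, hence surjective, hence
    bijective. *)
Lemma minimal_approx_exists M : fin_gen M ->
  exists n (f : {linear M -> 'rV[R]_n}), minimal_left_addR_approx f.
Proof.
move=> /(dual_fin_gen R_noetherian)/minimal_generators[s es smin].
pose n := size s; pose phi (i : 'I_n) : {linear M -> R^o} := map_of (s`_i : dual_module M).
exists n, (to_free phi); split; first split.
- exact: free_fg_projective.
- move=> Q h fgQ; have [l [i [r riE]]] := projective_retract fgQ.
  have gen (k : 'I_l) : exists c : 'I_n -> R, forall x, i (h x) 0 k = \sum_j c j * phi j x.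
    have : lin_span s (hom_of (coord_map R k \o i \o h) : dual_module M) by rewrite es.
    case=> c ec; exists c => x.
    have := congr1 (fun w : dual_module M => (w : hom_mod M R^o) x) ec.
    by rewrite hom_mod_sum.
  have [c cE] := choice gen.
  pose g : {linear 'rV[R]_n -> 'rV[R]_l} := from_free (fun j => \row_k c k j).
  exists (r \o g) => x; rewrite -[LHS]riE; congr (r _); apply/rowP => k.
  rewrite cE mk_linearE summxE; apply: eq_bigr => j _.
  by rewrite mxE to_freeE mxE mulrC.
- move=> g gf.
  pose G := \matrix_(i < n) g (delta_mx 0 i).
  have gG v : g v = v *m G.
    rewrite from_freeE mulmx_sum_row; apply: eq_bigr => i _.
    by rewrite rowK.
  have Gm i j : m (G i j - (i == j)%:R).
    apply: (smin (fun i => G i j - (i == j)%:R)); apply: hom_modP => x.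
    rewrite hom_mod_sum.
    have /rowP/(_ j) := gf x; rewrite gG mxE to_freeE => e.
    under eq_bigr do rewrite hom_modZ scalerBl.
    rewrite sumrB (bigD1 j) //= [X in _ - X](bigD1 j) //= eqxx scale1r.
    rewrite [X in _ - (_ + X)]big1 => [|k kj]; last by rewrite (negPf kj) scale0r.
    rewrite addr0 -[RHS](subrr (phi j x : R^o)); congr (_ - _).
    rewrite -[RHS]e [RHS](bigD1 j) //=.
    by congr (_ + _); [|apply: eq_bigr => k _]; rewrite mxE [RHS]mulrC.
  have gs : forall i, exists w, delta_mx 0 i = g w.
    move=> i; apply: (nakayama_seq R_noetherian R_local (submod_range g)
      (s := [seq delta_mx 0 i | i <- enum 'I_n])); last first.
      by apply/map_f; rewrite mem_enum.
    move=> _ /mapP[k _ ->]; exists (delta_mx 0 k - g (delta_mx 0 k)); last first.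
      by exists (delta_mx 0 k); rewrite opprB addrC subrK.
    rewrite [X in max_span _ _ X]row_sum_delta.
    apply: submod_sum; first exact: (submod_max_span R_local).
    move=> j; apply: (max_span_scale R_local); last first.
      by apply/mem_span/map_f; rewrite mem_enum.
    have := submodN (max_ideal_submod R_local) (Gm k j).
    by rewrite opprB !mxE eqxx [j == k]eq_sym.
  have [w wE] := choice gs.
  have WG : (\matrix_i w i) *m G = 1%:M.
    by apply/row_matrixP => i; rewrite row_mul rowK -gG -wE row1.
  have GW := mulmx1C WG.
  by exists (fun v => v *m \matrix_i w i) => v; rewrite gG -mulmxA ?GW ?WG mulmx1.
Qed.

End MinimalApproximation.

(** * Duals of free presentations *)

Section Dual.
Variable R : comNzRingType.
Implicit Types L M N P Q A B C E F G Y : lmodType R.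

Definition pair_map M A B (f : {linear M -> A}) (g : {linear M -> B}) :
    {linear M -> (A * B)%type} :=
  mk_linear (f := fun x => (f x, g x)) (fun a x y =>
    congr2 pair (linearP f a x y) (linearP g a x y)).

Lemma projective_prod P Q : projective P -> projective Q -> projective (P * Q)%type.
Proof.
move=> pP pQ A B g f gs.
have [u uE] := pP _ _ g (f \o prod_inl P Q) gs.
have [v vE] := pQ _ _ g (f \o prod_inr P Q) gs.
exists ((u \o prod_fst P Q) \+ (v \o prod_snd P Q)) => -[x y].
rewrite -[X in g X]/(u x + v y) linearD -uE -vE.
rewrite -[X in X + _]/(f (x, 0)) -[X in _ + X]/(f (0, y)) -linearD.
by congr (f (_, _)); rewrite ?addr0 ?add0r.
Qed.

Definition dual_basis n M (f : {linear M -> 'rV[R]_n}) (i : 'I_n) : dual_module M :=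
  hom_of (coord_map R i \o f).

Definition dual_from n M (f : {linear M -> 'rV[R]_n}) :
  {linear 'rV[R]_n -> dual_module M} :=
  from_free (dual_basis f).

Lemma dual_fromE n M (f : {linear M -> 'rV[R]_n}) a x :
  (dual_from f a : hom_mod M R^o) x = \sum_(i < n) a 0 i * f x 0 i.
Proof. by rewrite mk_linearE hom_mod_sum. Qed.

Definition dual_to n C (q : {linear 'rV[R]_n -> C}) : {linear dual_module C -> 'rV[R]_n} :=
  to_free (fun i => eval_at R^o (q (delta_mx 0 i))).

Lemma dual_toE n C (q : {linear 'rV[R]_n -> C}) (c : dual_module C) (a : 'rV[R]_n) :
  (c : hom_mod C R^o) (q a) = \sum_(i < n) a 0 i * dual_to q c 0 i.
Proof.
rewrite -[LHS]/((map_of (c : hom_mod C R^o) \o q) a) from_freeE.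
by apply: eq_bigr => i _; rewrite to_freeE.
Qed.

Definition dot n (p : 'rV[R]_n) : {linear 'rV[R]_n -> R^o} :=
  from_free (fun i => p 0 i : R^o).

Lemma dotE n (p a : 'rV[R]_n) : dot p a = \sum_(i < n) a 0 i * p 0 i.
Proof. by []. Qed.

Lemma linear_form_dot n (h : {linear 'rV[R]_n -> R^o}) a :
  h a = dot (\row_i h (delta_mx 0 i)) a.
Proof.
by rewrite from_freeE dotE; apply: eq_bigr => i _; rewrite [in RHS]mxE.
Qed.

Lemma dual_exact n M C (f : {linear M -> 'rV[R]_n}) (q : {linear 'rV[R]_n -> C}) :
  exact_at f q -> surjective_map q ->
  (forall g : {linear M -> R^o}, exists h : {linear 'rV[R]_n -> R^o},
      forall x, h (f x) = g x) ->
  short_exact (dual_to q) (dual_from f).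
Proof.
move=> fq qs fext; split.
- move=> c c' e; apply: hom_modP => y; have [a ->] := qs y.
  by rewrite !dual_toE e.
- move=> a; split=> [a0|[c ->]]; last first.
    apply: hom_modP => x; rewrite dual_fromE.
    under eq_bigr do rewrite mulrC.
    rewrite -dual_toE (_ : q (f x) = 0); last by apply/fq; exists x.
    exact: (linear0 (map_of (c : hom_mod C R^o))).
  have [g gE] : exists g : {linear C -> R^o}, forall b, g (q b) = dot a b.
    apply: factor_through_surj => // b /fq[x ->].
    have := congr1 (fun w : dual_module M => (w : hom_mod M R^o) x) a0.
    by rewrite dual_fromE dotE => h; rewrite -[RHS]h; apply: eq_bigr => i _; rewrite mulrC.
  exists (hom_of g); apply/rowP => i; rewrite to_freeE.
  rewrite -[RHS]/(g (q (delta_mx 0 i))) gE dotE (bigD1 i) //= mxE !eqxx mul1r.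
  by rewrite big1 ?addr0 // => j ji; rewrite mxE (negPf ji) andbF mul0r.
- move=> g; have [h hE] := fext (map_of (g : hom_mod M R^o)).
  exists (\row_i h (delta_mx 0 i)); apply: hom_modP => x; rewrite dual_fromE.
  rewrite -[LHS]/(map_of (g : hom_mod M R^o) x) -hE linear_form_dot dotE.
  by apply: eq_bigr => i _; rewrite mulrC.
Qed.

Lemma bijective_of A B (f : A -> B) : injective f -> surjective_map f -> bijective f.
Proof.
move=> fi /choice[g gE]; exists g => [x|y]; last by rewrite -gE.
by apply: fi; rewrite -gE.
Qed.

Lemma approx_dual_ext n M (f : {linear M -> 'rV[R]_n}) : left_addR_approx f ->
  forall g : {linear M -> R^o}, exists h : {linear 'rV[R]_n -> R^o},
    forall x, h (f x) = g x.
Proof.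
case=> _ fapp g; have [h hE] := fapp _ g (ring_fg_projective R).
by exists h => x; rewrite hE.
Qed.

(** A form [t] on [M*] gives a form on [R^n], that is, an element [p] of [R^n].  As
    [t] factors through [M*], the forms on [C] kill the image of [p]. *)
Lemma biduality_surjective n M C (f : {linear M -> 'rV[R]_n}) (q : {linear 'rV[R]_n -> C}) :
  exact_at f q -> surjective_map q ->
  (forall g : {linear M -> R^o}, exists h : {linear 'rV[R]_n -> R^o},
      forall x, h (f x) = g x) ->
  (forall c : C, (forall g : {linear C -> R^o}, g c = 0) -> c = 0) ->
  surjective_map (@biduality R M).
Proof.
move=> fq qs fext Ctl t; have [_ ex ds] := dual_exact fq qs fext.
pose T : {linear dual_module M -> R^o} := map_of (t : hom_mod (dual_module M) R^o).
pose p : 'rV[R]_n := \row_i T (dual_basis f i).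
have Tfrom a : T (dual_from f a) = \sum_(i < n) a 0 i * p 0 i.
  rewrite linear_sum; apply: eq_bigr => i _.
  by rewrite linearZZ mxE.
have /fq[x ex'] : q p = 0.
  apply: Ctl => g; rewrite -[LHS]/((hom_of g : hom_mod C R^o) (q p)) dual_toE.
  under eq_bigr do rewrite mulrC.
  rewrite -Tfrom (_ : dual_from f _ = 0) ?linear0 //.
  by apply/ex; exists (hom_of g).
exists x; apply: hom_modP => g; have [a ->] := ds g.
rewrite -[LHS]/(T (dual_from f a)) Tfrom.
by rewrite -[RHS]/((dual_from f a : hom_mod M R^o) x) dual_fromE -ex'.
Qed.

End Dual.

(** * Resolving subcategories closed under cosyzygies *)

Section Resolving.
Variables (R : comNzRingType) (m : set R) (d : nat).
Hypotheses (R_noetherian : noetherian_ring R) (R_local : local_ring m).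
Hypotheses (R_dim : krull_dim R d).
Hypothesis R_MCM : MCM m d (R^o : lmodType R).
Implicit Types L M N P Q A B C E F G Y : lmodType R.

Lemma free_MCM k : MCM m d ('rV[R]_k).
Proof.
by split; [apply: free_fin_gen|rewrite -free_submod0; apply: depth_ge_free; case: R_MCM].
Qed.

(** The first term of a maximal regular sequence on [R] avoids all minimal primes,
    hence all primes associated to maximal Cohen--Macaulay modules. *)
Lemma good_element : (0 < d)%N ->
  exists2 x, m x & forall M, MCM m d M -> regular_mod ([set 0] : set M) x.
Proof.
move=> d0; have [_] := R_MCM.
case: (d) d0 R_dim => // d' _ hd [x [mx xR _]]; exists x => // M [fgM dM].
apply: (regular_mod_max_depth R_noetherian R_local fgM (submod_zero M) hd dM).
by move=> y xy; apply: xR.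
Qed.

(** If no such [t] existed, the regular sequence [s] could be prolonged beyond the
    dimension. *)
Lemma socle_element (s : seq R) : size s = d -> regular_seq_mod m s ([set 0] : set R^o) ->
  exists2 t : R, ~ add_multiples_seq s ([set 0] : set R^o) t &
    forall a, m a -> add_multiples_seq s ([set 0] : set R^o) (a * t).
Proof.
move=> sz_s rs; apply: contrapT => h.
have h0 := submod_zero (R^o : lmodType R).
have [|z mz zr] := regular_element_exists R_noetherian R_local (ring_fin_gen R)
   (submod_add_multiples_seq s h0).
  by move=> e me; apply: contrapT => se; apply: h; exists e.
have dd : depth_ge m d.+1 ([set 0] : set R^o).
  apply/depth_geP; exists (rcons s z); first by rewrite size_rcons sz_s.
  exact/regular_seq_mod_rcons.
have := @depth_ge_krull _ _ R_noetherian R_local _ _ _ _ 1 (ring_fin_gen R) h0 R_dim dd.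
by rewrite ltnn => /(_ _)[]//; apply/eqP/oner_neq0.
Qed.

Lemma regular_seq_mod_prod M N s (U : set M) (V : set N) : submod U -> submod V ->
  regular_seq_mod m s [set p : M * N | U p.1 /\ V p.2] ->
    regular_seq_mod m s U /\ regular_seq_mod m s V.
Proof.
elim: s U V => //= x s IH U V hU hV [mx /(regular_mod_prod _ hU hV)[xU xV]].
have -> : add_multiples [set p : M * N | U p.1 /\ V p.2] x =
          [set p : M * N | add_multiples U x p.1 /\ add_multiples V x p.2].
  apply/seteqP; split=> -[a b].
    case=> -[u v] [[y z] [[/= Uu Vv] [-> ->]]]; split; first by exists u, y.
    by exists v, z.
  case=> /= -[u [y [Uu ->]]] [v [z [Vv ->]]].
  by exists (u, v), (y, z).
by move=> /(IH _ _ (submod_add_multiples x hU) (submod_add_multiples x hV))[].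
Qed.

Lemma preimage_add_multiples_seq L M N (f : {linear L -> M}) (g : {linear M -> N})
  s (U : set M) :
  exact_at f g -> surjective_map g -> submod U -> regular_seq_mod m s (g @` U) ->
  f @^-1` (add_multiples_seq s U) = add_multiples_seq s (f @^-1` U).
Proof.
move=> ex gs; elim: s U => //= x s IH U hU [mx xg rs].
rewrite IH; first by rewrite (preimage_add_multiples ex hU xg).
  exact: submod_add_multiples.
by rewrite (image_add_multiples gs).
Qed.

Lemma add_multiples_seq_free k s (U : set R^o) :
  add_multiples_seq s (@free_submod R k U) = free_submod (add_multiples_seq s U).
Proof. by elim: s U => //= x s IH U; rewrite add_multiples_free IH. Qed.

(** The Auslander--Buchsbaum argument: if [R^n -> R^l] has a maximal
    Cohen--Macaulay cokernel, then it remains injective modulo a maximal regular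
    sequence [s], and multiplication by a socle element of [R / (s)] shows that it
    is injective modulo [m]. *)
Lemma minimal_presentation_MCM n l G (a : {linear 'rV[R]_n -> 'rV[R]_l})
    (q : {linear 'rV[R]_l -> G}) (v : 'rV[R]_n) :
  injective a -> exact_at a q -> surjective_map q -> MCM m d (R^o * G)%type ->
  (forall i, m (a v 0 i)) -> forall j, m (v 0 j).
Proof.
move=> ai aq qs [_ dRG] mav j; apply: contrapT => mvj.
have [u uv] := local_unit R_noetherian R_local mvj.
have hR := submod_zero (R^o : lmodType R); have hG := submod_zero G.
have [s sz_s] := (depth_geP _ _ _).1 dRG.
have -> : [set 0] = [set p : R^o * G | [set 0] p.1 /\ [set 0] p.2].
  by apply/seteqP; split=> [_ -> //|[x y] /= [-> ->]].
case/(regular_seq_mod_prod hR hG) => rR rG.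
have [t st mt] := socle_element sz_s rR.
have im0 : q @` [set 0] = [set 0].
  apply/seteqP; split=> [_ [x -> <-]|_ ->]; first by rewrite /= linear0.
  by exists 0; rewrite ?linear0.
have pre0 : a @^-1` [set 0] = [set 0].
  apply/seteqP; split=> [x /= ax|_ ->]; last by rewrite /preimage /= linear0.
  by apply: ai; rewrite linear0.
have e := @preimage_add_multiples_seq _ _ _ a q s [set 0] aq qs (submod_zero _).
rewrite im0 in e; have {}e := e rG.
have : (a @^-1` add_multiples_seq s [set 0]) (t *: v).
  rewrite -free_submod0 add_multiples_seq_free => i; rewrite linearZZ mxE mulrC.
  exact: mt.
rewrite e pre0 -free_submod0 add_multiples_seq_free => /(_ j); rewrite mxE => stv.
apply: st; rewrite -[t]mulr1 -uv mulrCA.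
exact: (submodZ u (submod_add_multiples_seq s hR) stv).
Qed.

Section Main.
Variable X : lmodType R -> Prop.
Hypotheses (X_resolving : resolving X) (X_MCM : forall M, X M -> MCM m d M)
  (X_cosyzygy : closed_under_cosyzygies X) (d_gt0 : (0 < d)%N).

Lemma X_ext L M N (f : {linear L -> M}) (g : {linear M -> N}) :
  short_exact f g -> X L -> X N -> X M.
Proof. by case: X_resolving => _ _ _ h _; apply: h. Qed.

Lemma X_ker L M N (f : {linear L -> M}) (g : {linear M -> N}) :
  short_exact f g -> X M -> X N -> X L.
Proof. by case: X_resolving => _ _ _ _; apply. Qed.

Lemma X_free n : X ('rV[R]_n).
Proof. by case: X_resolving => _ h _ _ _; apply/h/free_fg_projective. Qed.

Lemma X_fin_gen M : X M -> fin_gen M.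
Proof. by move=> /X_MCM[]. Qed.

Lemma X_approx M : X M -> exists n (f : {linear M -> 'rV[R]_n}) C
    (q : {linear 'rV[R]_n -> C}),
  [/\ left_addR_approx f, exact_at f q, surjective_map q & X C].
Proof.
move=> XM; have [n [f fm]] := minimal_approx_exists R_noetherian R_local (X_fin_gen XM).
exists n, f, _, (quotient_map (submod_range f)).
have qs := quotient_map_surj (submod_range f).
have ex : exact_at f (quotient_map (submod_range f)) by move=> y; rewrite quotient_map_eq0.
split=> //; first by case: fm.
by apply: (X_cosyzygy XM); exists 'rV[R]_n, f, (quotient_map (submod_range f)).
Qed.

(** Let [x] be a regular element and [L] the preimage of [xE] in a free cover of
    [E], an extension of [E] by its syzygy.  If all forms kill [e], then by
    [Ext^1(E, R) = 0] those on [L] take multiples of [x] as values at [x] times a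
    lift of [e]; as [x] is regular on the cosyzygy of [L], this gives
    [e] in [xE], and Nakayama's lemma applies. *)
Lemma torsionless_of_ext1 E : X E -> ext1 E R^o ->
  forall e : E, (forall g : {linear E -> R^o}, g e = 0) -> e = 0.
Proof.
move=> XE extE.
have [x mx xreg] := good_element d_gt0.
have xinj M (XM : MCM m d M) : injective (scale_by M x).
  by apply: injective_ker => y xy; apply: (xreg M).
have fgE := X_fin_gen XE.
have [k [p ps]] := fin_gen_free fgE.
pose Y := submodule (submod_ker p);
  pose iY : {linear Y -> _} := submodule_incl (submod_ker p).
have exY : short_exact iY p := ker_exact ps.
have XY : X Y := X_ker exY (X_free k) XE.
have hL := submod_preimage p (submod_range (scale_by E x)).
pose L := submodule hL; pose iL : {linear L -> _} := submodule_incl hL.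
have iLi : injective iL := @submodule_incl_inj _ _ _ hL.
have iYi : injective iY by case: exY.
have pY y : p (iY y) = 0 by case: exY => _ h _; apply/h; exists y.
have [jY jYE] : exists jY : {linear Y -> L}, forall y, iL (jY y) = iY y.
  apply: lift_along_inj => // y; apply: submodule_incl_ex.
  by exists 0; rewrite pY linear0.
have [qL qLE] : exists qL : {linear L -> E}, forall l, scale_by E x (qL l) = (p \o iL) l.
  apply: lift_along_inj; first exact: xinj (X_MCM XE).
  by move=> l; have := submodule_inclP l.
have XL : X L.
  apply: (X_ext (f := jY) (g := qL) _ XY XE); split.
  - by move=> y y' e; apply: iYi; rewrite -!jYE e.
  - move=> l; split=> [l0|[y ->]].
      have [_ /(_ (iL l))[h _] _] := exY; case: h => [|y ey].
        by rewrite -[LHS]/((p \o iL) l) -qLE l0 linear0.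
      by exists y; apply: iLi; rewrite jYE.
    apply: (xinj E (X_MCM XE)); rewrite qLE linear0 -[LHS]/(p (iL (jY y))).
    by rewrite jYE pY.
  - move=> e; have [a ea] := ps (x *: e).
    have [l el] : exists l, a = iL l by apply: submodule_incl_ex; exists e; rewrite -ea.
    exists l; apply: (xinj E (X_MCM XE)).
    by rewrite qLE -[RHS]/(p (iL l)) -el -ea.
have [n [f [C [q [fapp fq qs XC]]]]] := X_approx XL.
have fext := approx_dual_ext fapp.
have fi : injective f.
  apply: injective_ker => l fl0; apply: iLi; rewrite linear0; apply/rowP => i.
  have [h hE] := fext (coord_map R i \o iL).
  have := hE l; rewrite fl0 linear0 mxE => h0.
  by rewrite -[LHS]/((coord_map R i \o iL) l) -h0.
pose W := [set e : E | forall g : {linear E -> R^o}, g e = 0].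
have hW : submod W.
  split=> [g|a y z Wy Wz g]; first by rewrite linear0.
  by rewrite linearP Wy Wz scaler0 addr0.
move=> e0; apply: (nakayama R_noetherian R_local fgE hW (submod_zero E)).
move=> e We; have [a ea] := ps e.
have [mulx mulxE] : exists mulx : {linear 'rV[R]_k -> L}, forall b,
  iL (mulx b) = scale_by _ x b.
  apply: lift_along_inj => // b; apply: submodule_incl_ex; exists (p b).
  exact: linearZZ.
(* On [Y], the form [g \o mulx] agrees with [x *: t], where [t] extends [g] from
   [Y] to the free module, so the difference descends to a form on [E]. *)
have key (g : {linear L -> R^o}) : exists r : R^o, g (mulx a) = x *: r.
  have [t tE] := extE _ _ _ _ exY (g \o jY).
  have [h hE] : exists h : {linear E -> R^o},
     forall b, h (p b) = ((g \o mulx) \- (scale_by _ x \o t)) b.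
    apply: factor_through_surj => // b pb.
    have [_ /(_ b)[/(_ pb)[y ey] _] _] := exY.
    rewrite -[LHS]/(g (mulx b) - x *: t b) ey tE.
    rewrite (_ : mulx (iY y) = x *: jY y); first by rewrite linearZZ subrr.
    by apply: iLi; rewrite mulxE linearZZ jYE.
  exists (t a); apply/eqP; rewrite -subr_eq0.
  by rewrite -[_ - _]/(((g \o mulx) \- (scale_by _ x \o t)) a) -hE -ea We.
have /choice[r rE] : forall i, exists r : R, f (mulx a) 0 i = x * r.
  by move=> i; apply: (key (coord_map R i \o f)).
have fx : f (mulx a) = x *: \row_i r i.
  by apply/rowP => i; rewrite rE !mxE.
have /fq[l el] : q (\row_i r i) = 0.
  apply: (xreg C (X_MCM XC)); rewrite -linearZZ -fx.
  by apply/fq; eexists.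
have al : a = iL l.
  apply: (xinj _ (free_MCM k)); rewrite -mulxE -[RHS]linearZZ; congr (iL _).
  by apply: fi; rewrite fx el linearZZ.
have [e' pe'] := submodule_inclP l.
have ee' : e = x *: e' by rewrite ea al.
exists x, e'; split=> //; last by rewrite ee' subrr.
move=> g; apply: (xreg _ R_MCM).
by rewrite -[_ *: _]linearZZ -ee' We.
Qed.

(** The group [Ext^1(M, R)] is a finitely generated module.  Let the [psi i]
    represent minimal generators; they define the universal extension
    [0 -> R^n -> E -> M -> 0], with [Ext^1(E, R) = 0].  Hence [E] embeds into some
    [R^l] with cokernel in [X], and [R^l / R^n] is in [X] too.  If [n > 0], the
    image of a basis vector in [R^l] is not divisible by [m], so some form on [E]
    takes the value 1 on it, which makes a generator redundant. *)
Lemma ext1_resolving M : X M -> ext1 M R^o.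
Proof.
move=> XM; have fgM := X_fin_gen XM.
have [k [p ps]] := fin_gen_free fgM.
pose Y := submodule (submod_ker p);
  pose iY : {linear Y -> _} := submodule_incl (submod_ker p).
have exY : short_exact iY p := ker_exact ps.
have iYi : injective iY by case: exY.
have pY y : p (iY y) = 0 by case: exY => _ h _; apply/h; exists y.
have XY : X Y := X_ker exY (X_free k) XM.
pose D := dual_module Y.
have hB := submod_range (precomp R^o iY).
have fgQ : fin_gen (quotient_module hB).
  apply: fin_gen_surj (quotient_map_surj hB) _.
  exact: dual_fin_gen R_noetherian (X_fin_gen XY).
have [s es smin] := minimal_generators R_noetherian R_local fgQ.
pose n := size s.
have [psi psiE] := choice (fun i : 'I_n => quotient_map_surj hB (s`_i)).
have gen (g : {linear Y -> R^o}) : exists (c : 'I_n -> R) (t : {linear 'rV[R]_k -> R^o}),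
    forall y, g y = \sum_i c i * psi i y + t (iY y).
  have : lin_span s (quotient_map hB (hom_of g)) by rewrite es.
  case=> c; under eq_bigr do rewrite psiE -linearZZ.
  rewrite -linear_sum => /eq_qproj[t et]; exists c, (map_of t) => y.
  have := congr1 (fun w : D => (w : hom_mod Y R^o) y) et.
  rewrite -[LHS]/(g y - (\sum_i c i *: psi i : D) y) hom_mod_sum => /eqP.
  by rewrite subr_eq addrC => /eqP.
have [n0|npos] := posnP n.
  apply: (ext1_presentation (@free_projective R k) exY) => g.
  have [c [t tE]] := gen g; exists t => y; rewrite tE.
  by rewrite big1 ?add0r // => i; have := ltn_ord i; rewrite [X in (_ < X)%N]n0.
exfalso.
pose psim : {linear Y -> 'rV[R]_n} := to_free (fun i => map_of (psi i : hom_mod Y R^o)).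
pose h : {linear Y -> ('rV[R]_n * 'rV[R]_k)%type} := pair_map psim iY.
have hi : injective h by move=> y y' [_ /iYi].
(* The universal extension is the pushout of [Y -> R^k] along [psim]. *)
pose E := quotient_module (submod_range h);
  pose qE : {linear _ -> E} := quotient_map (submod_range h).
have qEs : surjective_map qE := quotient_map_surj _.
have qE0 z : qE z = 0 <-> exists y, z = h y := quotient_map_eq0 _ z.
pose i1 : {linear 'rV[R]_n -> E} := qE \o prod_inl _ _.
have [q2 q2E] : exists q2 : {linear E -> M}, forall z, q2 (qE z) = (p \o prod_snd _ _) z.
  apply: factor_through_surj => // z /qE0[y ->]; exact: pY.
have exE : short_exact i1 q2.
  split.
  - apply: injective_ker => v /qE0[y [ev ey]].
    have y0 : y = 0 by apply: iYi; rewrite linear0; exact/esym/ey.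
    by rewrite ev y0; exact: (linear0 psim).
  - move=> z; have [[v b] ->] := qEs z; rewrite q2E; split=> [pb|[w ew]].
      have [_ /(_ b)[/(_ pb)[y ey] _] _] := exY.
      exists (v - psim y); apply/eqP; rewrite -subr_eq0 -[i1 _]/(qE (_, 0)) -linearB.
      apply/eqP/qE0; exists y.
      by congr (_, _); rewrite /= ?subr0 // opprB addrC subrK.
    by rewrite -q2E ew q2E -[LHS]/(p 0) linear0.
  - move=> x; have [b ->] := ps x; exists (qE (0, b)).
    by rewrite q2E.
have XE : X E := X_ext exE (X_free n) XM.
have extE : ext1 E R^o.
  apply: (ext1_presentation _ (coker_exact hi)).
    exact: projective_prod (@free_projective R n) (@free_projective R k).
  move=> g; have [c [t tE]] := gen g.
  exists ((dot (\row_i c i) \o prod_fst _ _) \+ (t \o prod_snd _ _)) => y.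
  rewrite tE -[LHS]/(dot _ (psim y) + t (iY y)) dotE; congr (_ + _).
  by apply: eq_bigr => i _; rewrite to_freeE mxE mulrC.
have Etl := torsionless_of_ext1 XE extE.
have [l [f [C [q [fapp fq qs XC]]]]] := X_approx XE.
have fext := approx_dual_ext fapp.
have fi : injective f.
  apply: injective_ker => e fe0; apply: Etl => g.
  by have [t <-] := fext g; rewrite fe0 linear0.
have [i1i i1q2 q2s] := exE.
pose a : {linear 'rV[R]_n -> 'rV[R]_l} := f \o i1.
have ai : injective a by move=> v v' /fi /i1i.
pose G := quotient_module (submod_range a);
  pose qG : {linear _ -> G} := quotient_map (submod_range a).
have qGs : surjective_map qG := quotient_map_surj _.
have qG0 z : qG z = 0 <-> exists y, z = a y := quotient_map_eq0 _ z.
have [u uE] : exists u : {linear M -> G}, forall e, u (q2 e) = (qG \o f) e.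
  apply: factor_through_surj => // e /i1q2[v ->].
  by apply/qG0; exists v.
have [w wE] : exists w : {linear G -> C}, forall z, w (qG z) = q z.
  by apply: factor_through_surj => // z /qG0[v ->]; apply/fq; exists (i1 v).
have XG : X G.
  apply: (X_ext (f := u) (g := w) _ XM XC); split.
  - apply: injective_ker => y; have [e ->] := q2s y; rewrite uE => /qG0[v /fi ->].
    by apply/i1q2; exists v.
  - move=> z; have [b ->] := qGs z; rewrite wE; split=> [/fq[e ->]|[y ey]].
      by exists (q2 e); rewrite uE.
    rewrite -wE ey; have [e ->] := q2s y; rewrite uE -[LHS]/(w (qG (f e))) wE.
    by apply/fq; exists e.
  - by move=> c; have [b ->] := qs c; exists (qG b); rewrite wE.
have XRG : X (R^o * G)%type.
  apply: (X_ext (prod_exact _ _) _ XG).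
  by case: X_resolving => _ hX _ _ _; apply/hX/ring_fg_projective.
pose i0 : 'I_n := Ordinal npos; pose v0 : 'rV[R]_n := delta_mx 0 i0.
have [i mi] : exists i, ~ m (a v0 0 i).
  apply: contrapT => ha; apply: (max_ideal_proper R_local).
  have aq : exact_at a qG by [].
  have := minimal_presentation_MCM ai aq qGs (X_MCM XRG) (v := v0) _ i0.
  rewrite mxE !eqxx; apply=> i; apply: contrapT => mi; apply: ha; by exists i.
have [r ra] := local_unit R_noetherian R_local mi.
(* The form [rho] takes the value 1 on the basis vector [i0]; as it vanishes on the
   relations [h y], it gives a relation between the generators, with a coefficient
   1 at [psi i0]. *)
pose rho : {linear E -> R^o} := scale_by _ r \o (coord_map R i \o f).
pose c j := rho (i1 (delta_mx 0 j)).
apply: (max_ideal_proper R_local); have <- : c i0 = 1 by [].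
apply: smin; under eq_bigr do rewrite psiE -linearZZ.
rewrite -linear_sum; apply/quotient_map_eq0.
exists (- hom_of (rho \o (qE \o prod_inr _ _))); apply: hom_modP => y.
rewrite hom_mod_sum -[RHS]/(- rho (qE (0, iY y))).
apply/eqP; rewrite -subr_eq0 opprK.
have e0 : rho (qE (h y)) = 0.
  by rewrite (_ : qE (h y) = 0) ?linear0 //; apply/qE0; exists y.
rewrite -[X in _ == X]e0.
have -> : h y = (psim y, 0) + (0, iY y) by congr (_, _); rewrite /= ?addr0 ?add0r.
rewrite !linearD; apply/eqP; congr (_ + _).
rewrite -[RHS]/((rho \o i1) (psim y)) from_freeE; apply: eq_bigr => j _.
by rewrite to_freeE; apply: mulrC.
Qed.

Lemma X_torsionless M : X M ->
  forall x : M, (forall g : {linear M -> R^o}, g x = 0) -> x = 0.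
Proof. by move=> XM; apply: torsionless_of_ext1 => //; apply: ext1_resolving. Qed.

Lemma X_reflexive M : X M -> bijective (@biduality R M).
Proof.
move=> XM; apply: bijective_of.
  move=> x y e; apply/eqP; rewrite -subr_eq0; apply/eqP/X_torsionless => // g.
  have := congr1 (fun w : dual_module (dual_module M) =>
    (w : hom_mod (dual_module M) R^o) (hom_of g)) e.
  by rewrite linearB => /= ->; rewrite subrr.
have [n [f [C [q [fapp fq qs XC]]]]] := X_approx XM.
exact: (biduality_surjective fq qs (approx_dual_ext fapp) (X_torsionless XC)).
Qed.

(** The syzygies of [M] lie in [X], and the syzygies of [M*] are duals of modules in
    [X]. *)
Lemma X_totally_reflexive M : X M -> totally_reflexive M.
Proof.
move=> XM; split; [exact: X_fin_gen|exact: X_reflexive|move=> i i0; split].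
  apply: (Ext_zero_class (K := X)) => // N XN.
  have [k [p ps]] := fin_gen_free (X_fin_gen XN).
  have ex := ker_exact ps.
  exists k, _, (submodule_incl (submod_ker p)), p; split=> //.
    exact: X_ker ex (X_free k) XN.
  exact: (ext1_resolving XN ex).
apply: (Ext_zero_class (K := fun N => exists2 M', X M' & N = dual_module M')) => //;
  last by exists M.
move=> _ [N XN ->].
have [n [f [C [q [fapp fq qs XC]]]]] := X_approx XN.
exists n, (dual_module C), (dual_to q), (dual_from f); split.
- exact: dual_exact fq qs (approx_dual_ext fapp).
- by exists C.
- move=> g; have [ev _ evK] := X_reflexive XC.
  have [b eb] := qs (ev (hom_of g)); exists (dot b) => c.
  have := congr1 (fun w : dual_module (dual_module C) =>
    (w : hom_mod (dual_module C) R^o) c) (evK (hom_of g)).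
  rewrite -[RHS]/(g c) => <-; rewrite -[RHS]/((c : hom_mod C R^o) (ev (hom_of g))).
  by rewrite eb dual_toE dotE; apply: eq_bigr => j _; rewrite mulrC.
Qed.

End Main.
End Resolving.

(** * Finite injective dimension *)

Section InjectiveExt.
Variables (R : comNzRingType) (m : set R).
Hypotheses (R_noetherian : noetherian_ring R) (R_local : local_ring m).
Variables (J : nat -> lmodType R) (dJ : forall i, {linear J i -> J i.+1}).
Variable aug : {linear R^o -> J 0%N}.
Hypotheses (J_inj : forall i, injective_module (J i)) (aug_inj : injective aug)
  (aug_exact : exact_at aug (dJ 0%N)) (dJ_exact : forall i, exact_at (dJ i) (dJ i.+1)).
Implicit Types L M N P Q A B C E F G Y : lmodType R.

Lemma dJdJ i x : dJ i.+1 (dJ i x) = 0.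
Proof. by apply/dJ_exact; exists x. Qed.

(** [Ext^(i+1)(M / U, R) = 0], computed with the injective resolution [J]. *)
Definition Ext_vanishes i M (U : set M) : Prop :=
  forall g : {linear M -> J i.+1}, (forall u, U u -> g u = 0) ->
    (forall x, dJ i.+1 (g x) = 0) ->
  exists2 h : {linear M -> J i}, (forall u, U u -> h u = 0) & (forall x, dJ i (h x) = g x).

(** For [k : M' -> M] there is an exact sequence
    [0 -> M' / k^-1 U -> M / U -> M / (U + k M') -> 0]; the lemmas below are the
    pieces of its long exact sequence. *)
Section LongExact.
Variables (M' M : lmodType R) (k : {linear M' -> M}) (U : set M) (hU : submod U).

Definition add_image : set M := [set y | exists u x, U u /\ y = u + k x].

Lemma add_image_vanish N (g : {linear M -> N}) : (forall u, U u -> g u = 0) ->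
  (forall x, g (k x) = 0) -> forall y, add_image y -> g y = 0.
Proof. by move=> gU gk _ [u [x [/gU gu ->]]]; rewrite linearD gu gk addr0. Qed.

Lemma add_image_base u : U u -> add_image u.
Proof. by move=> Uu; exists u, 0; rewrite linear0 addr0. Qed.

Lemma add_image_image x : add_image (k x).
Proof. by exists 0, x; rewrite add0r; split=> //; case: hU. Qed.

Lemma submod_add_image : submod add_image.
Proof.
split; first by apply: add_image_base; case: hU.
move=> a _ _ [u [x [Uu ->]]] [v [y [Uv ->]]]; exists (a *: u + v), (a *: x + y).
by split; [case: hU => _; apply|rewrite linearP scalerDr addrACA].
Qed.

Lemma cocycle_extends i (g : {linear M' -> J i.+1}) : Ext_vanishes i.+1 add_image ->
  (forall x, U (k x) -> g x = 0) -> (forall x, dJ i.+1 (g x) = 0) ->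
  exists h : {linear M -> J i.+1},
    [/\ forall u, U u -> h u = 0, forall x, dJ i.+1 (h x) = 0 & forall x, h (k x) = g x].
Proof.
move=> exV gU gc.
have [h0 h0k h0U] := injective_module_ext (@J_inj i.+1) hU gU.
have [||h hV hE] := exV (dJ i.+1 \o h0).
- apply: add_image_vanish => [u Uu|x]; rewrite -[LHS]/(dJ i.+1 (h0 _)).
    by rewrite h0U // linear0.
  by rewrite h0k gc.
- by move=> x; apply: dJdJ.
exists (h0 \- h); split=> [u Uu|x|x] /=.
- by rewrite h0U // hV ?subr0 //; apply: add_image_base.
- by rewrite linearB hE subrr.
- by rewrite h0k hV ?subr0 //; apply: add_image_image.
Qed.

Lemma Ext_vanishes_sub i : Ext_vanishes i U -> Ext_vanishes i.+1 add_image ->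
  Ext_vanishes i (k @^-1` U).
Proof.
move=> exU exV g gU gc; have [g' [g'U g'c g'k]] := cocycle_extends exV gU gc.
have [h hU' hE] := exU g' g'U g'c.
by exists (h \o k) => [x /hU'|x] //=; rewrite hE.
Qed.

Lemma Ext_vanishes_mid i : Ext_vanishes i (k @^-1` U) -> Ext_vanishes i add_image ->
  Ext_vanishes i U.
Proof.
move=> exU' exV g gU gc.
have [|x|h' h'U h'E] := exU' (g \o k); [by move=> x /gU|exact: gc|].
have [h0 h0k h0U] := injective_module_ext (@J_inj i) hU h'U.
have [||h1 h1V h1E] := exV (g \- (dJ i \o h0)).
- apply: add_image_vanish => [u Uu|x]; rewrite -[LHS]/(g _ - dJ i (h0 _)).
    by rewrite gU // h0U // linear0 subrr.
  by rewrite h0k h'E subrr.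
- by move=> x; rewrite linearB gc dJdJ subrr.
exists (h0 \+ h1) => [u Uu|x] /=.
  by rewrite h0U // h1V ?addr0 //; apply: add_image_base.
by rewrite linearD h1E -[X in _ + X]/(g x - dJ i (h0 x)) addrC subrK.
Qed.

Lemma Ext_vanishes_quo i : Ext_vanishes i (k @^-1` U) -> Ext_vanishes i.+1 U ->
  Ext_vanishes i.+1 add_image.
Proof.
move=> exU' exU g gV gc.
have [u /add_image_base /gV //|//|h hU0 hE] := exU g.
have [|x|h' h'U h'E] := exU' (h \o k); first by move=> x /hU0.
  by rewrite -[LHS]/(dJ i.+1 (h (k x))) hE gV //; apply: add_image_image.
have [h0 h0k h0U] := injective_module_ext (@J_inj i) hU h'U.
exists (h \- (dJ i \o h0)) => [|x].
  apply: add_image_vanish => [u Uu|x]; rewrite -[LHS]/(h _ - dJ i (h0 _)).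
    by rewrite hU0 // h0U // linear0 subrr.
  by rewrite h0k h'E subrr.
by rewrite linearB hE dJdJ subr0.
Qed.

End LongExact.

Definition is_coboundary i N : {linear N -> J i} -> Prop :=
  match i with
  | 0%N => fun b => forall x, b x = 0
  | i'.+1 => fun b => exists h : {linear N -> J i'}, forall x, dJ i' (h x) = b x
  end.

Definition Ext_fin_gen i N : Prop :=
  exists n (c : 'I_n -> {linear N -> J i}), (forall j x, dJ i (c j x) = 0) /\
    forall g : {linear N -> J i}, (forall x, dJ i (g x) = 0) ->
    exists (a : 'I_n -> R) (b : {linear N -> J i}), is_coboundary b /\
      forall x, g x = \sum_j a j *: c j x + b x.

Lemma Ext_fin_gen0 N : fin_gen N -> Ext_fin_gen 0 N.
Proof.
move=> /(dual_fin_gen R_noetherian)[s es].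
exists (size s), (fun j => aug \o map_of (s`_j : dual_module N)); split=> [j x|g gc].
  by apply/aug_exact; eexists.
have [g' g'E] := lift_along_inj aug_inj (fun x => (aug_exact _).1 (gc x)).
have : lin_span s (hom_of g' : dual_module N) by rewrite es.
case=> a ea; exists a, \0; split=> // x.
rewrite -g'E -[g' x]/((hom_of g' : hom_mod N R^o) x) ea hom_mod_sum linear_sum addr0.
by apply: eq_bigr => j _; rewrite hom_modZ linearZZ.
Qed.

(** Dimension shifting along a free cover [R^n -> N] with kernel [Y]: cocycles on
    [N] in degree [i + 1] come from cocycles on [Y] in degree [i]. *)
Lemma Ext_fin_gen_step i N : (forall Y, fin_gen Y -> Ext_fin_gen i Y) ->
  fin_gen N -> Ext_fin_gen i.+1 N.
Proof.
move=> IH fgN; have [n [p ps]] := fin_gen_free fgN.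
have hY := submod_ker p; pose Y := submodule hY;
  pose iY : {linear Y -> _} := submodule_incl hY.
have iYP b : p b = 0 -> exists y, b = iY y by move/(submodule_incl_ex hY).
have pY y : p (iY y) = 0 by apply: submodule_inclP y.
have iYi : injective iY := submodule_incl_inj hY.
have [k [c [cc cgen]]] := IH Y (submodule_fin_gen R_noetherian hY (free_fin_gen R n)).
have /choice[ch chE] : forall j, exists h : {linear 'rV[R]_n -> J i},
    forall y, c j y = h (iY y).
  by move=> j; apply: J_inj.
have /choice[cN cNE] : forall j, exists g : {linear N -> J i.+1},
    forall b, g (p b) = (dJ i \o ch j) b.
  move=> j; apply: factor_through_surj => // b /iYP[y ->].
  by rewrite -[LHS]/(dJ i (ch j (iY y))) -chE cc.
exists k, cN; split=> [j x|g gc].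
  by have [b ->] := ps x; rewrite cNE; apply: dJdJ.
have [h hE] : exists h : {linear 'rV[R]_n -> J i}, forall b, dJ i (h b) = (g \o p) b.
  by apply: free_lift => b; apply/dJ_exact/gc.
have [y|a [b [bb ab]]] := cgen (h \o iY).
  by rewrite -[LHS]/(dJ i (h (iY y))) hE -[LHS]/(g (p (iY y))) pY linear0.
have [e [eb ed]] : exists e : {linear 'rV[R]_n -> J i},
    (forall y, b y = e (iY y)) /\ forall x, dJ i (e x) = 0.
  case: (i) b bb {c cc cgen ch chE cN cNE h hE ab} => [|i'] b /=.
    by move=> b0; exists \0; split=> // x; rewrite linear0.
  case=> u uE; have [u' u'E] := @J_inj i' _ _ iY u iYi.
  exists (dJ i' \o u'); split=> [y|x]; last exact: dJdJ.
  by rewrite -uE u'E.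
pose lc : {linear 'rV[R]_n -> J i} := map_of (\sum_j a j *: hom_of (ch j)).
have lcE x : lc x = \sum_j a j *: ch j x by rewrite mk_linearE hom_mod_sum.
have [g' g'E] : exists g' : {linear N -> J i}, forall x, g' (p x) = ((h \- lc) \- e) x.
  apply: factor_through_surj => // x /iYP[y ->].
  rewrite -[LHS]/(h (iY y) - lc (iY y) - e (iY y)) -eb lcE.
  rewrite -[h (iY y)]/((h \o iY) y) ab.
  under [X in _ - X - _]eq_bigr do rewrite -chE.
  by rewrite addrAC addrK subrr.
exists a, (dJ i \o g'); split; first by exists g'.
move=> x; have [z ->] := ps x.
rewrite -[X in _ + X]/(dJ i (g' (p z))) g'E.
rewrite -[dJ i _]/(dJ i (h z - lc z - e z)) !linearB ed subr0 hE lcE linear_sum.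
rewrite -[(g \o p) z]/(g (p z)) [RHS]addrC.
under [X in _ - X]eq_bigr do rewrite linearZZ.
by under [X in _ + X]eq_bigr do rewrite cNE; rewrite subrK.
Qed.

Lemma Ext_fin_gen_all i N : fin_gen N -> Ext_fin_gen i N.
Proof.
by elim: i N => [|i IH] N; [apply: Ext_fin_gen0|apply: Ext_fin_gen_step].
Qed.

(** As [y] is regular and [Ext^(i+2)] of [M / (U + yM)] vanishes, every cocycle on
    [M / U] is divisible by [y]; and [Ext^(i+1)(M / U, R)] is
    finitely generated. *)
Lemma Ext_vanishes_nakayama i M (U : set M) y : fin_gen M -> submod U -> m y ->
  regular_mod U y -> Ext_vanishes i.+1 (add_multiples U y) -> Ext_vanishes i U.
Proof.
move=> fgM hU my yU exV.
pose N := quotient_module hU; pose q : {linear M -> N} := quotient_map hU.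
have qs : surjective_map q := quotient_map_surj hU.
have divisible (g : {linear N -> J i.+1}) : (forall x, dJ i.+1 (g x) = 0) ->
    exists2 c : {linear N -> J i.+1}, (forall x, dJ i.+1 (c x) = 0) &
      forall x, g x = y *: c x.
  move=> gc.
  have [||c [cU cc cE]] := @cocycle_extends M M (scale_by M y) U hU i (g \o q) exV.
  - by move=> x /yU Ux; rewrite -[LHS]/(g (q x)) (quotient_map_eq0 hU x).2 ?linear0.
  - by move=> x; apply: gc.
  have [c' c'E] : exists c' : {linear N -> J i.+1}, forall x, c' (q x) = c x.
    by apply: factor_through_surj => // x /quotient_map_eq0 /cU.
  exists c' => x; have [z ->] := qs x; first by rewrite c'E.
  by rewrite c'E -linearZZ cE.
have [n [c [cc cgen]]] := Ext_fin_gen_all i.+1 (fin_gen_surj qs fgM).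
pose H := hom_mod N (J i.+1).
pose B := [set b : H | exists h : {linear N -> J i}, forall x, dJ i (h x) = b x].
have hB : submod B.
  split; first by exists \0 => x; rewrite linear0.
  move=> r b b' [h hE] [h' h'E]; exists ((r \*: h) \+ h') => x.
  by rewrite linearD linearZZ hE h'E.
pose s : seq H := [seq hom_of (c j) | j <- enum 'I_n].
have cs j : hom_of (c j) \in s by apply: map_f; rewrite mem_enum.
have cB j : B (hom_of (c j)).
  apply: (nakayama_seq R_noetherian R_local hB (s := s)) (cs j) => _ /mapP[l _ ->].
  have [c' c'c c'E] := divisible (c l) (cc l).
  have [a [b [[h hE] ab]]] := cgen c' c'c.
  exists (y *: \sum_j a j *: hom_of (c j)).
    apply: (max_span_scale R_local) => //; apply: submod_sum; first exact: submod_span.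
    by move=> k; apply: submodZ; [apply: submod_span|apply: mem_span].
  exists (y \*: h) => x; rewrite linearZZ hE.
  rewrite -[RHS]/(c l x - y *: (\sum_j a j *: hom_of (c j) : H) x).
  by rewrite c'E ab hom_mod_sum -scalerBr addrC addKr.
move=> g gU gc.
have [g' g'E] : exists g' : {linear N -> J i.+1}, forall x, g' (q x) = g x.
  by apply: factor_through_surj => // x /quotient_map_eq0 /gU.
have [x|a [b [[h hE] ab]]] := cgen g'.
  by have [z ->] := qs x; rewrite g'E.
have [h' h'E] : B (\sum_j a j *: hom_of (c j)).
  by apply: submod_sum => // j; apply: submodZ.
exists ((h' \+ h) \o q) => [u Uu|x].
  by rewrite -[LHS]/((h' \+ h) (q u)) (quotient_map_eq0 hU u).2 ?linear0.
rewrite -[LHS]/(dJ i (h' (q x) + h (q x))) linearD h'E hE -g'E ab.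
by rewrite hom_mod_sum.
Qed.

(** Each term of a regular sequence shifts the degree by one. *)
Lemma Ext_vanishes_regular_seq i M s (U : set M) : fin_gen M -> submod U ->
  regular_seq_mod m s U -> Ext_vanishes (i + size s) (add_multiples_seq s U) ->
    Ext_vanishes i U.
Proof.
move=> fgM; elim: s i U => [|x s IH] i U hU; first by rewrite addn0.
case=> mx xU rs; rewrite /= addnS -addSn => ex.
by apply: Ext_vanishes_nakayama (IH _ _ (submod_add_multiples x hU) rs ex).
Qed.

Lemma ext1_of_Ext_vanishes M : Ext_vanishes 0 ([set 0] : set M) -> ext1 M R^o.
Proof.
move=> ex A A' i q [ii iq qs] g.
have [b0 b0E] := @J_inj 0%N _ _ i (aug \o g) ii.
have [c cE] : exists c : {linear M -> J 1%N}, forall x, c (q x) = (dJ 0%N \o b0) x.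
  apply: factor_through_surj => // x /iq[a ->].
  rewrite -[LHS]/(dJ 0%N (b0 (i a))) -b0E; apply/aug_exact.
  by exists (g a).
have [u ->|x|h _ hE] := ex c; first exact: linear0.
  by have [a ->] := qs x; rewrite cE; apply: dJdJ.
have [b bE] : exists b : {linear A' -> R^o}, forall x, aug (b x) = (b0 \- (h \o q)) x.
  apply: lift_along_inj => // x; apply/aug_exact.
  by rewrite linearB -[dJ _ ((h \o q) x)]/(dJ _ (h (q x))) hE cE subrr.
exists b => x; apply: aug_inj; rewrite bE.
rewrite -[LHS]/(b0 (i x) - h (q (i x))) -b0E (_ : q (i x) = 0) ?linear0 ?addr0 //.
by apply/iq; exists x.
Qed.

Lemma Ext_vanishes_ring i : Ext_vanishes i ([set 0] : set R^o).
Proof.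
move=> g _ gc; have /dJ_exact[y ey] := gc 1.
exists (from_ring y) => [u ->|x]; first exact: linear0.
by rewrite mk_linearE linearZZ -ey [RHS]linear_ring.
Qed.

(** Dividing by a regular sequence of length [n] raises the projective dimension by
    at most [n]. *)
Lemma Ext_vanishes_perfect j s (U : set R^o) : submod U ->
  (forall i, (j <= i)%N -> Ext_vanishes i U) -> regular_seq_mod m s U ->
  forall i, (j + size s <= i)%N -> Ext_vanishes i (add_multiples_seq s U).
Proof.
elim: s j U => [|x s IH] j U hU ex; first by rewrite addn0.
case=> mx xU rs /= i; rewrite addnS -addSn; apply: (IH) rs i.
  exact: submod_add_multiples.
move=> [//|i] ji; apply: (@Ext_vanishes_quo _ _ (scale_by R^o x) U hU i); last first.
  by apply: ex; apply: leqW.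
have -> : scale_by R^o x @^-1` U = U; last exact: ex.
by apply/seteqP; split=> [y /xU //|y Uy]; apply: submodZ.
Qed.

Variable d : nat.
Hypotheses (R_dim : krull_dim R d) (R_MCM : MCM m d (R^o : lmodType R)).
Variable n : nat.
Hypothesis J_zero : forall i, (n < i)%N -> zero_module (J i).

Lemma colon_max e : forall M (U : set M) (x : M), submod U -> ~ U x ->
  (forall a, m a -> U (a *: x)) -> U (e *: x) -> m e.
Proof.
move=> M U x hU Ux mU Uex; apply: contrapT => me.
have [u ue] := local_unit R_noetherian R_local me.
by apply: Ux; rewrite -[x]scale1r -ue -scalerA; apply: submodZ.
Qed.

(** The residue field embeds into [R / (s)] for a maximal regular sequence [s], and
    [R / (s)] has projective dimension [d]. *)
Lemma Ext_vanishes_residue_field i : (d <= i)%N ->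
  (forall M (U : set M), fin_gen M -> submod U -> Ext_vanishes i.+1 U) ->
  Ext_vanishes i (m : set R^o).
Proof.
move=> di ex; have h0 := submod_zero (R^o : lmodType R).
have [s sz_s rs] := (depth_geP _ _ _).1 (proj2 R_MCM).
have [t st mt] := socle_element R_noetherian R_local R_dim sz_s rs.
have hs := submod_add_multiples_seq s h0.
have -> : (m : set R^o) = from_ring (t : R^o) @^-1` add_multiples_seq s [set 0].
  by apply/seteqP; split=> [a /mt //|a sa]; apply: (colon_max hs st mt sa).
apply: Ext_vanishes_sub => //.
  apply: (Ext_vanishes_perfect (j := 0) h0 _ rs); last by rewrite sz_s.
  by move=> ? _; apply: Ext_vanishes_ring.
by apply: ex; [apply: ring_fin_gen|apply: submod_add_image].
Qed.

(** Noetherian induction on [U].  For [y] in [m] regular on [M / U], Nakayama's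
    lemma applies; otherwise [M / U] is an extension of quotients of [M] by larger
    submodules, or of such a quotient by the residue field. *)
Lemma Ext_vanishes_descend i : (d <= i)%N ->
  (forall M (U : set M), fin_gen M -> submod U -> Ext_vanishes i.+1 U) ->
  forall M (U : set M), fin_gen M -> submod U -> Ext_vanishes i U.
Proof.
move=> di ex M U0 fgM hU0; apply: contrapT => nex.
have [U [hU nexU Umax]] := submod_maximal R_noetherian fgM hU0
   (P := fun U => ~ Ext_vanishes i U) nex.
have bigger V e : submod V -> U `<=` V -> V e -> ~ U e -> Ext_vanishes i V.
  by move=> hV UV Ve Ue; apply: contrapT => nV; apply/Ue/(Umax V hV nV UV).
apply: nexU; case: (pselect (exists y e, m y /\ ~ U (y *: e))) => [[y [e [my Uye]]]|mMU].
  case: (pselect (regular_mod U y)) => [yU|/existsNP[z /not_implyP[Uyz Uz]]].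
    by apply: Ext_vanishes_nakayama my yU _ => //; apply: ex => //;
      apply: submod_add_multiples.
  apply: (@Ext_vanishes_mid _ _ (scale_by M y) U hU).
    by apply: (bigger _ z) => //; [apply: submod_preimage|move=> u; apply: submodZ].
  apply: (bigger _ (y *: e)) => //; first exact: submod_add_image.
    exact: add_image_base.
  exact: (add_image_image _ hU).
have {}mMU a e : m a -> U (a *: e).
  by move=> ma; apply: contrapT => Uae; apply: mMU; exists a, e.
case: (pselect (exists e, ~ U e)) => [[e Ue]|Ufull]; last first.
  have UT x : U x by apply: contrapT => Ux; apply: Ufull; exists x.
  move=> g gU _; exists \0 => // x.
  by rewrite linear0 gU.
apply: (@Ext_vanishes_mid _ _ (from_ring e) U hU).
  have -> : from_ring e @^-1` U = m; last exact: Ext_vanishes_residue_field.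
  apply/seteqP; split=> [a Ua|a ma]; last exact: mMU.
  exact: (colon_max hU Ue (fun b mb => mMU b e mb) Ua).
apply: (bigger _ e) => //; first exact: submod_add_image.
  exact: add_image_base.
by rewrite -[X in add_image _ _ X](scale1r e); apply: (add_image_image (from_ring e) hU 1).
Qed.

Lemma ext1_MCM M : MCM m d M -> ext1 M R^o.
Proof.
have base i : (n <= i)%N -> forall M (U : set M), Ext_vanishes i U.
  move=> ni N U g _ _; exists \0 => // x; rewrite linear0.
  exact/esym/(@J_zero i.+1).
have all_i i : forall j, (d <= i)%N -> (n <= i + j)%N ->
    forall N (U : set N), fin_gen N -> submod U -> Ext_vanishes i U.
  move=> j; elim: j i => [|j IH] i di; first by rewrite addn0 => /base h N U _ _.
  rewrite addnS -addSn => nij; apply: Ext_vanishes_descend => // N U.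
  by apply: (IH) nij N U; apply: leqW.
move=> [fgM /depth_geP[s sz_s rs]]; apply: ext1_of_Ext_vanishes.
have h0 := submod_zero M.
apply: (Ext_vanishes_regular_seq fgM h0 rs); rewrite sz_s add0n.
apply: (all_i d n) => //; first exact: leq_addl.
exact: submod_add_multiples_seq.
Qed.

End InjectiveExt.

(** * The category of maximal Cohen--Macaulay modules *)

Section CMCategory.
Variables (R : comNzRingType) (m : set R) (d : nat).
Hypotheses (R_noetherian : noetherian_ring R) (R_local : local_ring m).
Hypothesis R_MCM : MCM m d (R^o : lmodType R).
Implicit Types L M N P Q A B C E F G Y Z : lmodType R.

Lemma preimage_zero M N (f : {linear M -> N}) : injective f -> f @^-1` [set 0] = [set 0].
Proof.
move=> fi; apply/seteqP; split=> [x /= fx|_ ->]; last by rewrite /preimage /= linear0.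
by apply: fi; rewrite linear0.
Qed.

Lemma image_zero M N (f : {linear M -> N}) : f @` [set 0] = [set 0].
Proof.
apply/seteqP; split=> [_ [x -> <-]|_ ->]; first by rewrite /= linear0.
by exists 0; rewrite ?linear0.
Qed.

Lemma MCM_ext L M N (f : {linear L -> M}) (g : {linear M -> N}) :
  short_exact f g -> MCM m d L -> MCM m d N -> MCM m d M.
Proof.
move=> ex [fgL dL] [fgN dN]; have fgM := fin_gen_ext ex fgL fgN.
split=> //; case: ex => fi ex gs.
apply: (depth_ge_ext R_noetherian R_local ex gs fgL fgM (submod_zero M)).
  by rewrite preimage_zero.
by rewrite image_zero.
Qed.

Lemma depth_ge_syzygy k L M N (f : {linear L -> M}) (g : {linear M -> N}) :
  short_exact f g -> MCM m d M -> (k < d)%N -> depth_ge m k ([set 0] : set N) ->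
  depth_ge m k.+1 ([set 0] : set L).
Proof.
move=> [fi ex gs] [fgM dM] kd dN.
have := @depth_ge_ker _ _ R_noetherian R_local _ _ _ f g k [set 0] ex gs fgM
  (submod_zero M).
by rewrite preimage_zero // image_zero; apply=> //; apply: depth_ge_leq dM.
Qed.

Lemma MCM_ker L M N (f : {linear L -> M}) (g : {linear M -> N}) :
  short_exact f g -> MCM m d M -> MCM m d N -> MCM m d L.
Proof.
move=> ex MM [fgN dN]; have fi : injective f by case: ex.
split; first by apply: fin_gen_inj fi _ => //; case: MM.
case: (d) dN MM (@depth_ge_syzygy) => // d' dN MM syz.
by apply: syz ex MM _ _ => //; apply: depth_geW.
Qed.

Lemma MCM_retract A B (i : {linear A -> B}) (r : {linear B -> A}) :
  (forall a, r (i a) = a) -> MCM m d B -> MCM m d A.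
Proof.
move=> ri [fgB dB]; split.
  by apply: (fin_gen_surj (f := r)) fgB => a; exists (i a); rewrite ri.
rewrite -(@preimage_zero _ _ i).
  apply: depth_ge_retract ri (submod_zero B) _ dB => _ ->.
  by rewrite !linear0.
by apply: can_inj ri.
Qed.

Lemma MCM_prod M N : MCM m d M -> MCM m d N -> MCM m d (M * N)%type.
Proof. exact: MCM_ext (prod_exact M N). Qed.

Lemma MCM_projective P : fg_projective P -> MCM m d P.
Proof.
move=> /projective_retract[n [i [r ri]]].
by apply: MCM_retract ri _; apply: free_MCM.
Qed.

Lemma MCM_resolving : resolving (MCM m d).
Proof.
split.
- split=> [M []//|M N [f [g fK gK]] MM].
  have [h hE] : exists h : {linear N -> M}, forall x, f (h x) = idfun x.
    by apply: lift_along_inj; [exact: can_inj fK|move=> x; exists (g x)].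
  by apply: MCM_retract hE MM.
- exact: MCM_projective.
- by move=> M N; apply: (@MCM_retract _ _ (prod_inl M N) (prod_fst M N)).
- by move=> L M N f g; apply: MCM_ext.
- by move=> L M N f g; apply: MCM_ker.
Qed.

(** ** Cosyzygies when [Ext^1(-, R)] vanishes on the category *)

Section Cosyzygies.
Hypothesis ext1_MCM : forall M, MCM m d M -> ext1 M R^o.

Lemma MCM_cover M : MCM m d M ->
  exists n Y (j : {linear Y -> 'rV[R]_n}) (p : {linear 'rV[R]_n -> M}),
    short_exact j p /\ MCM m d Y.
Proof.
move=> MM; have [n [p ps]] := fin_gen_free (proj1 MM).
have ex := ker_exact ps.
by exists n, _, (submodule_incl (submod_ker p)), p; split=> //;
  apply: MCM_ker ex _ MM; apply: free_MCM.
Qed.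

Lemma dual_cover_exact n Y M (j : {linear Y -> 'rV[R]_n}) (p : {linear 'rV[R]_n -> M}) :
  short_exact j p -> MCM m d M -> short_exact (dual_to p) (dual_from j).
Proof.
move=> ex MM; have [_ jp ps] := ex.
by apply: dual_exact => //; apply: ext1_MCM ex.
Qed.

(** Dualizing a free resolution of [M] exhibits [M*] as a syzygy of any order. *)
Lemma MCM_dual M : MCM m d M -> MCM m d (dual_module M).
Proof.
move=> MM; split; first by apply: dual_fin_gen => //; case: MM.
suff H k : (k <= d)%N -> forall N, MCM m d N ->
  depth_ge m k ([set 0] : set (dual_module N)).
  exact: H MM.
elim: k => // k IH kd N NN; have [n [Y [j [p [ex YY]]]]] := MCM_cover NN.
apply: (depth_ge_syzygy (dual_cover_exact ex NN) _ kd _); first exact: free_MCM.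
exact: (IH (ltnW kd) Y YY).
Qed.

(** Let [Y] be the syzygy of [M].  Then [Ext^1(Y*, R) = 0], so a form on [M*] extends
    to the dual of the free cover of [M], that is, comes from an element of the
    cover. *)
Lemma MCM_biduality_surj M : MCM m d M -> surjective_map (@biduality R M).
Proof.
move=> MM t; have [n [Y [j [p [ex YY]]]]] := MCM_cover MM.
have [h hE] := ext1_MCM (MCM_dual YY) (dual_cover_exact ex MM)
  (map_of (t : hom_mod (dual_module M) R^o)).
exists (p (\row_i h (delta_mx 0 i))); apply: hom_modP => g.
rewrite -[LHS]/(map_of (t : hom_mod (dual_module M) R^o) g) -hE linear_form_dot.
rewrite -[RHS]/((g : hom_mod M R^o) _) dual_toE dotE.
by apply: eq_bigr => i _; rewrite mulrC.
Qed.

(** An element [p a] killed by all forms defines, through [a], an element of the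
    bidual of the syzygy [Y]; this comes from [Y], so that [a] lies in [Y]. *)
Lemma MCM_torsionless M : MCM m d M ->
  forall x : M, (forall g : {linear M -> R^o}, g x = 0) -> x = 0.
Proof.
move=> MM x0 x00; have [n [Y [j [p [ex YY]]]]] := MCM_cover MM.
have [_ jp ps] := ex; have [_ ex' ds] := dual_cover_exact ex MM.
have [a ea] := ps x0.
have [t tE] : exists t : {linear dual_module Y -> R^o}, forall b,
  t (dual_from j b) = dot a b.
  apply: factor_through_surj => // b /ex'[c ->]; rewrite dotE.
  under eq_bigr do rewrite mulrC.
  by rewrite -dual_toE -ea; apply: (x00 (map_of (c : hom_mod M R^o))).
have [y ey] := MCM_biduality_surj YY (hom_of t).
rewrite ea; apply/jp; exists y; apply/rowP => i.
have := congr1 (fun w : dual_module (dual_module Y) =>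
  (w : hom_mod (dual_module Y) R^o) (dual_from j (delta_mx 0 i))) ey.
rewrite -[LHS]/(t (dual_from j (delta_mx 0 i))) tE dotE.
rewrite -[RHS]/((dual_from j (delta_mx 0 i) : hom_mod Y R^o) y) dual_fromE.
have pick (v : 'rV[R]_n) : \sum_k (delta_mx 0 i : 'rV[R]_n) 0 k * v 0 k = v 0 i.
  rewrite (bigD1 i) //= mxE !eqxx mul1r big1 ?addr0 // => k ki.
  by rewrite mxE (negPf ki) andbF mul0r.
by rewrite !pick.
Qed.

Fact biduality_linear M : linear (@biduality R M).
Proof. by move=> a x y; apply: hom_modP => g;
  apply: (linearP (map_of (g : hom_mod M R^o))). Qed.

(** Dualize a free cover of [M*], with syzygy [Z]; the cokernel is [Z*]. *)
Lemma MCM_embedding M : MCM m d M ->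
  exists n C (f : {linear M -> 'rV[R]_n}) (q : {linear 'rV[R]_n -> C}),
    short_exact f q /\ MCM m d C.
Proof.
move=> MM; have DD := MCM_dual MM.
have [n [Z [j [r [ex ZZ]]]]] := MCM_cover DD.
have [ri rj rs] := dual_cover_exact ex DD.
pose bid : {linear M -> dual_module (dual_module M)} := mk_linear (@biduality_linear M).
have bids : surjective_map bid := MCM_biduality_surj MM.
exists n, (dual_module Z), (dual_to r \o bid), (dual_from j); split; last exact: MCM_dual.
split=> //.
- apply: injective_ker => x; rewrite -(linear0 (dual_to r)) => /ri bx.
  apply: MCM_torsionless MM _ _ => g.
  exact: (congr1 (fun w : dual_module (dual_module M) =>
    (w : hom_mod (dual_module M) R^o) (hom_of g)) bx).
- move=> y; split=> [/rj[t ->]|[x ->]]; last by apply/rj; eexists.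
  by have [x ->] := bids t; exists x.
Qed.

Lemma extend_to_projective M C F P (f : {linear M -> F}) (q : {linear F -> C})
    (g : {linear M -> P}) :
  short_exact f q -> ext1 C R^o -> fg_projective P ->
  exists h : {linear F -> P}, forall x, h (f x) = g x.
Proof.
move=> ex extC /projective_retract[n [i [r ri]]].
have /choice[h hE] : forall k : 'I_n, exists h : {linear F -> R^o},
    forall x, h (f x) = (coord_map R k \o i \o g) x by move=> k; apply: extC ex _.
exists (r \o to_free h) => x; rewrite -[RHS]ri; congr (r _); apply/rowP => k.
by rewrite to_freeE hE.
Qed.

(** Comparing the cosyzygy [C] with the cokernel [C'] of another embedding of [M]
    in a free module shows that [C] is a direct summand of [C' * P]. *)
Lemma MCM_closed_under_cosyzygies : closed_under_cosyzygies (MCM m d).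
Proof.
move=> M C MM [P [f' [p' [[[fgP fapp] _] p's fp']]]].
have [n [C' [f [t [ex MC']]]]] := MCM_embedding MM.
have [u uE] := extend_to_projective f' ex (ext1_MCM MC') fgP.
have [v vE] := fapp _ f (free_fg_projective R n).
have [fi ft ts] := ex.
have p'f' x : p' (f' x) = 0 by apply/fp'; exists x.
have tf x : t (f x) = 0 by apply/ft; exists x.
have [ub ubE] : exists ub : {linear C' -> C}, forall a, ub (t a) = (p' \o u) a.
  by apply: factor_through_surj => // _ /ft[x ->]; rewrite -[LHS]/(p' (u _)) uE p'f'.
have [vb vbE] : exists vb : {linear C -> C'}, forall a, vb (p' a) = (t \o v) a.
  by apply: factor_through_surj => // _ /fp'[x ->]; rewrite -[LHS]/(t (v _)) -vE tf.
have [h hE] : exists h : {linear C -> P}, forall a, h (p' a) = ((u \o v) \- idfun) a.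
  apply: factor_through_surj => // _ /fp'[x ->].
  by rewrite -[LHS]/(u (v (f' x)) - f' x) -vE uE subrr.
have MP := MCM_prod MC' (MCM_projective fgP).
apply: (@MCM_retract _ _ (pair_map vb h)
  ((ub \o prod_fst C' P) \- (p' \o prod_snd C' P))) MP => c.
have [a ->] := p's c; rewrite -[LHS]/(ub (vb (p' a)) - p' (h (p' a))).
rewrite vbE ubE hE -[LHS]/(p' (u (v a)) - p' (u (v a) - a)).
by rewrite linearB opprB addrC subrK.
Qed.

End Cosyzygies.
End CMCategory.

(** * Enough injectives *)

Section Baer.
Variable R : comNzRingType.
Implicit Types A B E : lmodType R.

Definition baer E : Prop := forall (I : set R^o) (hI : submod I)
  (g : {linear submodule hI -> E}), exists e : E, forall i,
    g i = (submodule_incl hI i : R) *: e.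

(** Baer's criterion: Zorn's lemma gives a maximal partial extension, handled as
    a graph in [B * E]; the criterion makes its domain the whole of [B]. *)
Lemma baer_injective E : baer E -> injective_module E.
Proof.
move=> bE A B i f ii.
pose good (G : set (B * E)%type) := [/\ submod G, forall e, G (0, e) -> e = 0 &
  forall a, G (i a, f a)].
have chain (F : set (set (B * E)%type)) :
    F `<=` (fun G => G !=set0 -> good G) -> total_on F subset ->
    \bigcup_(Y in F) Y !=set0 -> good (\bigcup_(Y in F) Y).
  move=> FP tot [z [Z FZ Zz]].
  have goodF Y y : F Y -> Y y -> good Y by move=> FY Yy; apply: (FP Y FY); exists y.
  have [[Z0 _] _ Zbase] := goodF Z z FZ Zz; split.
  - split; first by exists Z.
    move=> a x y [Y FY Yx] [Y' FY' Yy].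
    have [[_ hY] _ _] := goodF Y x FY Yx; have [[_ hY'] _ _] := goodF Y' y FY' Yy.
    have [YY'|Y'Y] := tot _ _ FY FY'.
      by exists Y' => //; apply: hY' => //; apply: YY'.
    by exists Y => //; apply: hY => //; apply: Y'Y.
  - by move=> e [Y FY Ye]; have [_ h _] := goodF Y _ FY Ye; apply: h.
  - by move=> a; exists Z.
have [G [PG Gmax]] := Zorn_bigcup chain.
have [G0 G0E] : exists G0 : set (B * E)%type, forall x, G0 x <-> exists a, x = (i a, f a).
  by exists [set x | exists a, x = (i a, f a)].
have good0 : good G0.
  split.
  - have -> : G0 = [set x | exists a, x = pair_map i f a].
      by apply/seteqP; split=> x /G0E.
    exact: submod_range.
  - by move=> e /G0E[a [e0 ->]]; rewrite (_ : a = 0) ?linear0 //; apply: ii;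
    rewrite linear0.
  - by move=> a; apply/G0E; exists a.
have [hG Gfun Gbase] : good G.
  apply: PG; apply: contrapT => G_empty.
  have G0' : G0 (i 0, f 0) by apply/G0E; exists 0.
  apply: (Gmax G0) => //; split=> [x Gx|]; first by case: G_empty; exists x.
  by move=> h; apply: G_empty; exists (i 0, f 0); apply: h.
suff total b : exists e, G (b, e).
  have [a x y x' y' Gx Gy|e /Gfun //|h hE] := linear_of_relation total.
    exact: (proj2 hG a (x, y) (x', y')).
  by exists h => a; apply/esym/hE/Gbase.
have hI : submod ([set s : R^o | exists e, G ((s : R) *: b, e)]).
  split; first by exists 0; rewrite scale0r; case: hG.
  move=> a s t [e Ge] [e' Ge']; exists (a *: e + e').
  by rewrite scalerDl -scalerA; apply: (proj2 hG a (_, _) (_, _)).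
have [||y|g gE] := @linear_of_relation R (submodule hI) E
    (fun s e => G ((submodule_incl hI s : R) *: b, e)).
- by move=> s; apply: submodule_inclP s.
- move=> a s e s' e' Ge Ge'; rewrite linearP scalerDl -scalerA.
  exact: (proj2 hG a (_, _) (_, _)).
- by rewrite linear0 scale0r; apply: Gfun.
have [e0 e0E] := bE _ hI g; exists e0.
pose G' := [set x | exists z (s : R), G z /\ x = z + s *: (b, e0)].
have G'good : good G'.
  split.
  - split; first by exists 0, 0; split; [case: hG|rewrite scale0r addr0].
    move=> a _ _ [z [s [Gz ->]]] [z' [s' [Gz' ->]]]; exists (a *: z + z'), (a * s + s').
    by split; [case: hG => _; apply|rewrite scalerDr scalerDl scalerA addrACA].
  - move=> e [[z e'] [s [Gz [ez ->]]]].
    have Gs : G ((- s) *: b, e').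
      by rewrite (_ : (- s) *: b = z) // scaleNr; apply/eqP; rewrite eq_sym -addr_eq0 -ez.
    have Is : [set s : R^o | exists e, G ((s : R) *: b, e)] (- s) by exists e'.
    have [t et] := submodule_incl_ex hI Is.
    have : g t = e' by apply/gE; rewrite -et.
    by rewrite e0E -et scaleNr => <-; rewrite addNr.
  - by move=> a; exists (i a, f a), 0; rewrite scale0r addr0.
have GG' : G `<=` G' by move=> z Gz; exists z, 0; rewrite scale0r addr0.
have G'b : G' (b, e0) by exists 0, 1; rewrite scale1r add0r; split=> //; case: hG.
apply: contrapT => Gb; have GltG' : G `<` G'.
  by split=> // h; apply: Gb; apply: h.
exact: (Gmax G' GltG').
Qed.

End Baer.

(** ** The injective cogenerator of abelian groups *)

Section Integers.

Lemma int_ideal_principal (I : set (int^o)%type) : submod I ->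
  exists k : int, forall n : int, I n <-> exists q, n = q * k.
Proof.
move=> hI; have [In|noP] := pselect (exists n : nat, I n.+1%:Z); last first.
  exists 0 => n; split=> [In|[q ->]]; last by rewrite mulr0; case: hI.
  exists 0; rewrite mulr0; case: n In => [[|n]|n] // In; case: noP; exists n => //.
  by have := submodN hI In; rewrite NegzE opprK.
have exP : exists n : nat, `[< I n.+1%:Z >] by case: In => n In; exists n; apply/asboolP.
case: (ex_minnP exP) => k /asboolP Ik kmin; exists k.+1%:Z => n.
split=> [In'|[q ->]]; last exact: (submodZ q hI Ik).
exists (n %/ k.+1)%Z; rewrite {1}(divz_eq n k.+1).
suff -> : (n %% k.+1)%Z = 0 by rewrite addr0.
have Ir : I (n %% k.+1)%Z.
  by rewrite /modz; apply: (submodB hI In'); apply: (submodZ _ hI Ik).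
have := ltz_pmod n (isT : 0 < k.+1%:Z :> int).
have := modz_ge0 n (isT : k.+1%:Z != 0 :> int).
case: (n %% k.+1)%Z Ir => [[|r]|r] // Ir _; rewrite ltz_nat ltnS => rk.
have : (k <= r)%N by apply/kmin/asboolP.
by rewrite leqNgt rk.
Qed.

Lemma divisible_injective (D : lmodType int) :
  (forall (n : int) (x : D), n != 0 -> exists y, x = n *: y) -> injective_module D.
Proof.
move=> div; apply: baer_injective => I hI g.
have [k kE] := int_ideal_principal hI.
have Ik : I k by apply/kE; exists 1; rewrite mul1r.
have [ik ek] := submodule_incl_ex hI Ik.
have [e eE] : exists e, g ik = k *: e.
  have [k0|k0] := eqVneq k 0; last exact: div.
  exists 0; rewrite scaler0 (_ : ik = 0) ?linear0 //.
  by apply: (submodule_incl_inj hI); rewrite -ek k0 linear0.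
exists e => i; have /kE[q eq] := submodule_inclP i.
have -> : i = q *: ik.
  by apply: (submodule_incl_inj hI); rewrite linearZZ -ek eq.
by rewrite !linearZZ eE -ek scalerA.
Qed.

Definition integers : set (zmodule rat) := [set x | exists n : int, x = n%:~R].

Lemma submod_integers : submod integers.
Proof.
split; first by exists 0.
move=> a _ _ [n ->] [n' ->]; exists (a * n + n').
by rewrite rmorphD rmorphM /= scalezrE mulrzl.
Qed.

Definition QmodZ : lmodType int := quotient_module submod_integers.

Lemma QmodZ_injective : injective_module QmodZ.
Proof.
apply: divisible_injective => n x n0.
have [q ->] := quotient_map_surj submod_integers x.
exists (quotient_map submod_integers ((q : rat) / n%:~R)); rewrite -linearZZ;
  congr (quotient_map _ _).
by rewrite scalezrE -mulrzl mulrC divfK // intr_eq0.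
Qed.

(** If the order of [x] is [k], send [x] to the class of [1 / k], and to that of
    [1 / 2] if the order is infinite; then extend by injectivity. *)
Lemma QmodZ_cogenerator (M : lmodType int) (x : M) : x <> 0 ->
  exists h : {linear M -> QmodZ}, h x <> 0.
Proof.
move=> x0; have hU := submod_preimage (from_ring x) (submod_zero M).
have [k kE] := int_ideal_principal hU.
pose q : rat := if k == 0 then 2^-1 else k%:~R^-1.
have qk : exists n : int, q * k%:~R = n%:~R.
  rewrite /q; have [->|k0] := eqVneq k 0; first by exists 0; rewrite mulr0.
  by exists 1; rewrite mulVf ?intr_eq0.
have k1 : `|k|%N <> 1%N.
  move=> k1; apply: x0; rewrite -[x]scale1r; apply/(kE 1); exists k.
  by case: (k) k1 => [[|[|n]]|[|n]].
have qn : ~ integers q.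
  case=> n; rewrite /q; have [k0|k0] := eqVneq k 0 => e.
    have : (n * 2)%:~R = 1 :> rat by rewrite intrM -e mulVf.
    move/eqP; rewrite -[1]/(1%:~R) eqr_int => /eqP/(congr1 absz).
    by rewrite abszM; case: (`|n|%N) => [|[]].
  have : (n * k)%:~R = 1 :> rat by rewrite intrM -e mulVf ?intr_eq0.
  move/eqP; rewrite -[1]/(1%:~R) eqr_int => /eqP/(congr1 absz).
  rewrite abszM => /eqP; rewrite muln_eq1 => /andP[_ /eqP k1'].
  exact: k1.
pose r : QmodZ := quotient_map submod_integers q.
have hr := submod_range (from_ring x).
have [fx fxE] : exists fx : {linear int^o -> submodule hr}, forall n,
  submodule_incl hr (fx n) = from_ring x n.
  by apply: lift_along_inj; [exact: submodule_incl_inj|move=> n;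
    apply: submodule_incl_ex; exists n].
have [g gE] : exists g : {linear submodule hr -> QmodZ}, forall n, g (fx n) = from_ring r n.
  apply: factor_through_surj.
    by move=> y; have [n en] := submodule_inclP y; exists n;
      apply: (submodule_incl_inj hr); rewrite en fxE.
  move=> n fn0; have /kE[a ->] : (from_ring x @^-1` [set 0]) n.
    by apply: etrans (esym (fxE n)) _; rewrite fn0 linear0.
  rewrite mk_linearE -linearZZ; apply/quotient_map_eq0; have [b be] := qk; exists (a * b).
  by rewrite scalezrE -mulrzl !intrM -be -mulrA [q * _]mulrC.
have [h hE] := QmodZ_injective g (submodule_incl_inj hr).
exists h; have ex : x = submodule_incl hr (fx 1) by rewrite fxE mk_linearE scale1r.
by rewrite ex -hE gE mk_linearE scale1r => /quotient_map_eq0.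
Qed.

End Integers.

(** ** Coinduced modules *)

Section Coinduction.
Variables (R : comNzRingType) (D : lmodType int).

Lemma additive_int_linear (V : zmodType) (f : V -> D) :
  {morph f : x y / x + y} -> linear (f : zmodule V -> D).
Proof.
move=> fD; have f0 : f 0 = 0 by apply: (addrI (f 0)); rewrite -fD !addr0.
have fN x : f (- x) = - f x by apply: (addrI (f x)); rewrite -fD !subrr.
have fn x n : f (x *+ n) = f x *+ n.
  by elim: n => [|n IH]; rewrite ?mulr0n // !mulrS fD IH.
have fz (n : int) x : f (x *~ n) = n *: f x.
  rewrite -[n in RHS]intz scaler_int; case: n => n; first exact: fn.
  by rewrite !NegzE !mulrNz fN; congr (- _); apply: fn.
by move=> n x y; rewrite fD scalezrE fz.
Qed.

(** [Hom_Z(R, D)], with [a] acting by [h |-> h (_ * a)]. *)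
Definition coind := hom_mod (zmodule R) D.
HB.instance Definition _ := GRing.Zmodule.on coind.

Fact coind_scale_linear (a : R) (h : coind) :
  linear ((fun r => h (r * a)) : zmodule R -> D).
Proof.
apply: (@additive_int_linear R) => x y; rewrite mulrDl.
exact: (linearD (map_of (h : hom_mod (zmodule R) D))).
Qed.

Definition coind_scale (a : R) (h : coind) : coind :=
  hom_of (mk_linear (coind_scale_linear a h)).

Fact coind_scaleA a b h : coind_scale a (coind_scale b h) = coind_scale (a * b) h.
Proof. by apply: hom_modP => r; rewrite /= mulrA. Qed.
Fact coind_scale1 : left_id 1 coind_scale.
Proof. by move=> h; apply: hom_modP => r; rewrite /= mulr1. Qed.
Fact coind_scaleDr : right_distributive coind_scale +%R.
Proof. by move=> a g h; apply: hom_modP. Qed.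
Fact coind_scaleDl h : {morph coind_scale^~ h : a b / a + b}.
Proof.
move=> a b; apply: hom_modP => r; rewrite /= mulrDr.
exact: (linearD (map_of (h : hom_mod (zmodule R) D))).
Qed.

HB.instance Definition _ := GRing.Zmodule_isLmodule.Build R coind
  coind_scaleA coind_scale1 coind_scaleDr coind_scaleDl.

Definition coind_mod : lmodType R := coind.

Lemma coind_adjunction (M : lmodType R) (f : {linear zmodule M -> D}) :
  exists g : {linear M -> coind_mod}, forall x r, (g x : coind) r = f (r *: x).
Proof.
have lf x : linear ((fun r => f (r *: x)) : zmodule R -> D).
  by apply: (@additive_int_linear R) => r s; rewrite scalerDl; apply: (linearD f).
pose g x : coind_mod := hom_of (mk_linear (lf x)).
have lg : linear g.
  move=> a x y; apply: hom_modP => r.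
  rewrite -[LHS]/(f (r *: (a *: x + y))) -[RHS]/(f ((r * a) *: x) + f (r *: y)).
  by rewrite scalerDr scalerA; apply: (linearD f).
by exists (mk_linear lg).
Qed.

Lemma coind_injective : injective_module D -> injective_module coind_mod.
Proof.
move=> Dinj A B i f ii.
have lf1 : linear ((fun a => (f a : coind) 1) : zmodule A -> D).
  by apply: (@additive_int_linear A) => a b; rewrite linearD.
have li : linear ((fun a => i a) : zmodule A -> zmodule B).
  by move=> n a b; rewrite linearD scalezrE raddfMz.
have [h hE] := Dinj _ _ (mk_linear li) (mk_linear lf1) ii.
have [g gE] := coind_adjunction h; exists g => a; apply: hom_modP => r.
rewrite -[RHS]/((g (i a) : coind) r) gE -linearZZ.
have := hE (r *: a); rewrite !mk_linearE => <-.
by rewrite linearZZ -[RHS]/((f a : coind) (1 * r)) mul1r.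
Qed.

End Coinduction.

Section EnoughInjectives.
Variable R : comNzRingType.
Implicit Types A B C E F L M N Y : lmodType R.

Lemma function_module_injective (T : Type) (D : lmodType int) :
  injective_module D -> injective_module (T -> D : lmodType int).
Proof.
move=> Dinj A B i f ii.
have /choice[h hE] : forall t, exists h : {linear B -> D}, forall a, f a t = h (i a).
  move=> t; have lt : linear (fun a => f a t) by move=> n a b; rewrite linearP.
  exact: (Dinj _ _ i (mk_linear lt) ii).
have lh : linear ((fun b t => h t b) : B -> (T -> D)).
  by move=> n a b; apply/funext => t; rewrite linearP.
by exists (mk_linear lh) => a; apply/funext => t; rewrite hE.
Qed.

(** Evaluation embeds the group [M] into a power of [Q / Z], and by adjunction the
    module [M] into the module coinduced from that power. *)
Lemma enough_injectives M :
  exists E (i : {linear M -> E}), injective_module E /\ injective i.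
Proof.
pose T := {linear zmodule M -> QmodZ}.
pose F : lmodType int := (T -> QmodZ : lmodType int).
have lev : linear ((fun x (t : T) => t x) : zmodule M -> F).
  by move=> n x y; apply/funext => t; rewrite linearP.
have [g gE] := coind_adjunction (mk_linear lev).
exists (coind_mod R F), g; split.
  exact/coind_injective/function_module_injective/QmodZ_injective.
apply: injective_ker => x gx0; apply: contrapT => x0.
have [t t0] := @QmodZ_cogenerator (zmodule M) x x0.
apply: t0; have := congr1 (fun w => (w : coind R F) 1 t) gx0.
by rewrite gE scale1r.
Qed.

(** ** Finite injective dimension from vanishing of [Ext^1] on syzygies *)

Lemma zero_free : zero_module ('rV[R]_0).
Proof. by move=> x; apply/rowP => -[]. Qed.

Lemma finite_inj_dim_injective E : injective_module E -> finite_inj_dim E.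
Proof.
move=> Einj; pose I k : lmodType R := if k is 0%N then E else 'rV[R]_0.
have I_inj k : injective_module (I k).
  case: k => [//|k] A B i f _; exists \0 => x; exact: zero_free.
have I0 k : (0 < k)%N -> zero_module (I k) by case: k => // k _; apply: zero_free.
have e0 : exact_at (idfun : {linear E -> I 0%N}) (\0 : {linear I 0%N -> I 1%N}).
  by move=> y; split=> // _; exists y.
have eS k : exact_at (\0 : {linear I k -> I k.+1}) (\0 : {linear I k.+1 -> I k.+2}).
  by move=> y; split=> // _; exists 0; rewrite (I0 k.+1 _ y) // linear0.
have i0 : injective (idfun : {linear E -> I 0%N}) by [].
by exists (InjectiveResolution I_inj i0 e0 eS), 0%N.
Qed.

Lemma finite_inj_dim_prepend B E C (i : {linear B -> E}) (q : {linear E -> C}) :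
  injective_module E -> short_exact i q -> finite_inj_dim C -> finite_inj_dim B.
Proof.
move=> Einj [ii iq qs] [[I dI aug I_inj aug_inj e0 eS] [n I0]].
pose I' k : lmodType R := if k is k'.+1 then I k' else E.
pose d' k : {linear I' k -> I' k.+1} :=
  match k return {linear I' k -> I' k.+1} with 0%N => aug \o q | k'.+1 => dI k' end.
have I'_inj k : injective_module (I' k) by case: k => [|k]; [exact: Einj|exact: I_inj].
have e0' : exact_at i (d' 0%N).
  move=> y; split=> [h|/iq h]; first by apply/iq/aug_inj; rewrite linear0.
  by rewrite -[LHS]/(aug (q y)) h linear0.
have eS' k : exact_at (d' k) (d' k.+1).
  case: k => [|k]; last exact: eS.
  move=> y; split=> [/e0[x ->]|[x ->]]; last by apply/e0; exists (q x).
  by have [z ->] := qs x; exists z.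
exists (InjectiveResolution I'_inj ii e0' eS'), n.+1 => -[//|k] nk.
exact: I0.
Qed.

Fixpoint is_syzygy k N : Prop :=
  if k is k'.+1 then exists n N' (f : {linear N -> 'rV[R]_n}) (g : {linear 'rV[R]_n -> N'}),
    short_exact f g /\ is_syzygy k' N'
  else fin_gen N.

Lemma free_cover N : noetherian_ring R -> fin_gen N ->
  exists n Y (j : {linear Y -> 'rV[R]_n}) (p : {linear 'rV[R]_n -> N}),
    short_exact j p /\ fin_gen Y.
Proof.
move=> R_noetherian /fin_gen_free[n [p ps]].
exists n, _, (submodule_incl (submod_ker p)), p; split; first exact: ker_exact.
exact: submodule_fin_gen (free_fin_gen R n).
Qed.

(** Embed [B] into an injective module [E].  Dimension shifting in both variables
    turns the vanishing for [B] on syzygies of order [k + 1] into that for [E / B] on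
    syzygies of order [k]; for [k = 0] it is Baer's criterion. *)
Lemma finite_inj_dim_of_syzygies k B : noetherian_ring R ->
  (forall N, is_syzygy k N -> ext1 N B) -> finite_inj_dim B.
Proof.
move=> R_noetherian; elim: k B => [|k IH] B extB.
  apply/finite_inj_dim_injective/baer_injective => I hI g.
  have [|h hE] := extB (quotient_module hI) _ _ _ _ _ (quot_exact hI) g.
    exact: fin_gen_surj (quotient_map_surj hI) (ring_fin_gen R).
  by exists (h 1) => s; rewrite -hE [LHS]linear_ring.
have [E [i [Einj ii]]] := enough_injectives B.
have [C [q ex]] : exists C (q : {linear E -> C}), short_exact i q.
  by eexists; exists (quotient_map (submod_range i)); apply: coker_exact.
apply: (finite_inj_dim_prepend Einj ex); have [_ iq qs] := ex.
apply: IH => N sN.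
have fgN : fin_gen N.
  case: (k) sN => [//|k' [n [N' [f [g [[fi _ _] _]]]]]].
  exact: fin_gen_inj fi (free_fin_gen R n).
have [n [Y [j [p [exN fgY]]]]] := free_cover R_noetherian fgN.
have extY : ext1 Y B by apply: extB; exists n, N, j, p.
have [n' [Y' [j' [p' [exY _]]]]] := free_cover R_noetherian fgY.
have [j'i j'p' p's] := exY.
apply: (ext1_presentation (@free_projective R n) exN) => g.
have [t tE] : exists t : {linear 'rV[R]_n' -> E}, forall x, q (t x) = (g \o p') x.
  by apply: free_lift => x; have [y ey] := qs (g (p' x)); exists y.
have [b bE] : exists b : {linear Y' -> B}, forall y, i (b y) = (t \o j') y.
  apply: lift_along_inj => // y; apply/iq; apply: etrans (tE (j' y)) _.
  rewrite -[LHS]/(g (p' (j' y))) (_ : p' (j' y) = 0) ?linear0 //.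
  by apply/j'p'; exists y.
have [b' b'E] := extY _ _ _ _ exY b.
have [g' g'E] : exists g' : {linear Y -> E}, forall x, g' (p' x) = (t \- (i \o b')) x.
  apply: factor_through_surj => // _ /j'p'[y ->].
  by rewrite -[LHS]/(t (j' y) - i (b' (j' y))) b'E bE subrr.
have ji : injective j by case: exN.
have [G GE] := Einj _ _ j g' ji.
exists (q \o G) => y; rewrite -[LHS]/(q (G (j y))) -GE; have [x ->] := p's y.
rewrite g'E -[LHS]/(q (t x - i (b' x))) linearB tE (_ : q (i _) = 0) ?subr0 //.
by apply/iq; eexists.
Qed.

End EnoughInjectives.

(** * Gorenstein rings *)

Section Conclusion.
Variables (R : comNzRingType) (m : set R) (d : nat).
Hypotheses (R_noetherian : noetherian_ring R) (R_local : local_ring m).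
Hypotheses (R_dim : krull_dim R d) (R_MCM : MCM m d (R^o : lmodType R)).

Lemma syzygy_MCM N : is_syzygy d N -> MCM m d N.
Proof.
suff H k M : (k <= d)%N -> is_syzygy k M ->
    fin_gen M /\ depth_ge m k ([set 0] : set M) by apply: H.
elim: k M => [|k IH] M; first by [].
move=> kd [n [M' [f [g [ex sM']]]]]; split.
  by case: ex => fi _ _; apply: fin_gen_inj fi (free_fin_gen R n).
have [_ dM'] := IH M' (ltnW kd) sM'.
by apply: (depth_ge_syzygy R_noetherian R_local ex) kd dM'; apply: free_MCM.
Qed.

Lemma gorenstein_ext1 : gorenstein R -> forall M, MCM m d M -> ext1 M R^o.
Proof.
case=> -[J dJ aug J_inj aug_inj e0 eS] [n J0] M MM.
exact: (ext1_MCM R_noetherian R_local J_inj aug_inj e0 eS R_dim R_MCM J0 MM).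
Qed.

End Conclusion.

Theorem corollary4p10 (R : comNzRingType) (m : set R) (d : nat)
    (R_noetherian : noetherian_ring R) (R_local : local_ring m)
    (R_CM : cohen_macaulay_ring m) (R_dim : krull_dim R d) (d_gt0 : (0 < d)%N) :
  (forall X : lmodType R -> Prop,
     resolving X ->
     (forall M : lmodType R, X M -> maximal_CM m M) ->
     closed_under_cosyzygies X ->
     forall M : lmodType R, X M -> totally_reflexive M) /\
  (gorenstein R <-> closed_under_cosyzygies (@maximal_CM R m)).
Proof.
have CM_MCM M := maximal_CM_MCM R_noetherian R_local M R_dim.
have R_MCM : MCM m d (R^o : lmodType R).
  by apply/CM_MCM; split; [apply: ring_fin_gen|right].
have -> : @maximal_CM R m = MCM m d by apply/funext => M; apply/propext/CM_MCM.
split=> [X X_res X_CM X_cosyz M XM|].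
  exact: (X_totally_reflexive R_noetherian R_local R_dim R_MCM X_res X_CM).
split=> [/(gorenstein_ext1 R_noetherian R_local R_dim R_MCM) ext|cosyz].
  exact: MCM_closed_under_cosyzygies.
apply: (finite_inj_dim_of_syzygies (k := d) R_noetherian) => N /syzygy_MCM NN.
apply: (ext1_resolving R_noetherian R_local R_dim R_MCM (X := MCM m d)) => //.
  exact: MCM_resolving.
exact: NN.
Qed.
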